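(* Let $B\subset\mathbb{R}^n$ be a convex body for some $n>2$. Then the following three properties are equivalent: (i) $B$ is an ellipsoid centered at $0$; (ii) $B$ is centrally symmetric, and its intersection with every (affine) hyperplane has a center of symmetry, provided this intersection is not empty; (iii) every non-empty closed convex subset of $B$ is parkable in $B$.
   Context: A convex body is a compact convex set $B\subset\mathbb{R}^n$ with non-empty interior which contains $0$. Let $C\subseteq B$ be convex subsets of $\mathbb{R}^n$ with $0\in B$. $C$ is parkable in $B$ if some translate of $C$ is contained in $B$ and contains $0$, i.e. there is $v\in\mathbb{R}^n$ with $0\in C+v\subseteq B$. A center of symmetry for a convex set $C\subseteq\mathbb{R}^n$ is a point $p\in C$ such that $C=2p-C:=\{2p-x\mid x\in C\}$. $C$ has a center of symmetry if such a point exists. $C$ is centrally symmetric if $0\in C$ and $0$ is a center of symmetry for $C$ (so $C=-C$). *)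

(* Defs.v *)
From mathcomp Require Import all_boot all_order all_algebra.
From mathcomp Require Import all_classical all_reals all_analysis.

Set Implicit Arguments.
Unset Strict Implicit.
Unset Printing Implicit Defensive.

Import Order.TTheory GRing.Theory Num.Theory.
Import numFieldNormedType.Exports.

Local Open Scope classical_set_scope.
Local Open Scope ring_scope.

Definition dotr (R : realType) (n : nat) (x y : 'rV[R]_n) : R :=
  \sum_(i < n) x ord0 i * y ord0 i.

(* The library norm on 'rV[R]_n is the sup norm: it induces the usual topology,
   but its unit ball is a cube, hence the explicit Euclidean norm here. *)
Definition euclidean_unit_ball (R : realType) (n : nat) : set 'rV[R]_n :=
  [set x | Num.sqrt (dotr x x) <= 1].

Definition convex_body (R : realType) (n : nat) (B : set 'rV[R]_n) : Prop :=
  [/\ compact B, convex_set B, interior B !=set0 & B 0].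

(* A is required to be invertible, so ellipsoids are solid and full-dimensional. *)
Definition ellipsoid (R : realType) (n : nat) (c : 'rV[R]_n)
    (E : set 'rV[R]_n) : Prop :=
  exists2 A : 'M[R]_n, A \in unitmx &
    E = [set c + x *m A | x in @euclidean_unit_ball R n].

Definition affine_hyperplane (R : realType) (n : nat)
    (H : set 'rV[R]_n) : Prop :=
  exists a : 'rV[R]_n, exists b : R, a != 0 /\ H = [set x | dotr a x = b].

Definition center_of_symmetry (R : realType) (n : nat) (p : 'rV[R]_n)
    (C : set 'rV[R]_n) : Prop :=
  C p /\ C = [set 2 *: p - x | x in C].

Definition has_center_of_symmetry (R : realType) (n : nat)
    (C : set 'rV[R]_n) : Prop :=
  exists p : 'rV[R]_n, center_of_symmetry p C.

Definition centrally_symmetric (R : realType) (n : nat)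
    (C : set 'rV[R]_n) : Prop :=
  C 0 /\ center_of_symmetry 0 C.

Definition translate (R : realType) (n : nat) (v : 'rV[R]_n)
    (C : set 'rV[R]_n) : set 'rV[R]_n :=
  [set x + v | x in C].

Definition parkable (R : realType) (n : nat) (C B : set 'rV[R]_n) : Prop :=
  exists v : 'rV[R]_n, translate v C 0 /\ translate v C `<=` B.

(* Main.v *)
(* All three properties reduce to properties of the gauge g of B. The chords and
   hyperplane sections of B are themselves parkable, so (iii) makes the chord through 0
   maximal in every direction; its ends then have parallel supports, the gauges of B and
   -B have proportional subgradients, and hence B = -B (Hammer). For symmetric B, both
   (ii) and (iii) put a translate of each section B /\ H' inside the parallel central
   section B /\ H; shrinking H' to H yields a projection of norm one onto H, whatever
   the hyperplane H. It remains to prove the Blaschke-Kakutani theorem. Projections of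
   norm one restrict to three-dimensional subspaces. At a smooth point x with tangent
   hyperplane T they force the level sets of w |-> g (x + w) on T to be homothetic, so
   the reflection x |-> -x fixing T is an isometry; by density and compactness every
   direction carries such a reflection. These reflections exchange any two unit
   vectors, so the functionals defining them assemble into a symmetric bilinear form
   whose quadratic form is g ^ 2. *)

Require Import Defs.
From mathcomp Require Import all_boot all_order all_algebra.
From mathcomp Require Import all_classical all_reals all_analysis.
From mathcomp Require Import ring lra.
Import Order.TTheory GRing.Theory Num.Theory.
Import numFieldNormedType.Exports.

Set Implicit Arguments.
Unset Strict Implicit.
Unset Printing Implicit Defensive.

Local Open Scope classical_set_scope.
Local Open Scope ring_scope.

(** Gauges need not be differentiable, so both ratio arguments ([g] against its value at the
    opposite vector, and the level gauge [L] against [g]) rest on one fact: two positive functions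
    on a segment with a common relative subgradient are proportional. The subgradient must be
    bounded, hence the segment must miss 0, and opposite vectors can only be compared through a
    third, independent one. The projections are used in the span of x and two tangent vectors:
    projecting onto the plane of x and w, smoothness at x forces the direction of projection to be
    tangent. A reflection along x - y exchanges the unit vectors x and y only if their line meets
    the ball in nothing beyond the segment; this is why all unit vectors are first shown to be
    extreme. Linearity of the final form costs nothing: a symmetric pairing that is linear in one
    argument is linear in the other. *)

(* The logarithms of P and Q share the subgradient s, so over one step of length 1/N the
   ratio P/Q loses at most s' - s + O(1/N), divided by N; the sum telescopes. *)
Lemma proportional_subgradients (R : realType) (P Q s : R -> R) (K : R) :
  (forall t, 0 <= t <= 1 -> [/\ 0 < P t, 0 < Q t & `|s t| <= K]) ->
  (forall t u, 0 <= t <= 1 -> 0 <= u <= 1 -> P t * (1 + s t * (u - t)) <= P u) ->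
  (forall t u, 0 <= t <= 1 -> 0 <= u <= 1 -> Q t * (1 + s t * (u - t)) <= Q u) ->
  P 1 * Q 0 = P 0 * Q 1.
Proof.
wlog suff : P Q / (forall t, 0 <= t <= 1 -> [/\ 0 < P t, 0 < Q t & `|s t| <= K]) ->
  (forall t u, 0 <= t <= 1 -> 0 <= u <= 1 -> P t * (1 + s t * (u - t)) <= P u) ->
  (forall t u, 0 <= t <= 1 -> 0 <= u <= 1 -> Q t * (1 + s t * (u - t)) <= Q u) ->
  P 0 * Q 1 <= P 1 * Q 0.
  move=> W h hP hQ; apply/eqP; rewrite eq_le W // andbT.
  have h' t : 0 <= t <= 1 -> [/\ 0 < Q t, 0 < P t & `|s t| <= K] by move=> /h[].
  by have := W _ _ h' hQ hP; rewrite mulrC [X in _ <= X]mulrC.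
move=> h hP hQ.
have [P0 Q0 K0] := h 0 ltac:(lra).
have [P1 Q1 _] := h 1 ltac:(lra).
have Kge0 : 0 <= K by apply: le_trans K0.
(* The bound K + 1 <= N keeps the factors 1 + s/N and 1 - s/N positive. In the error, 2 K bounds the
   telescoped s 1 - s 0 and K ^ 2 collects N products of two values of s, each over N ^ 2. *)
suff H : forall N : nat, K + 1 <= N%:R ->
    P 0 * Q 1 * (1 - (2 * K + K ^+ 2) / N%:R) <= P 1 * Q 0.
  apply/ler_addgt0Pl => e e0.
  pose c := P 0 * Q 1 * (2 * K + K ^+ 2).
  have c0 : 0 <= c by rewrite /c; apply: mulr_ge0; [nra | nra].
  pose N := (Num.truncn (K + 1 + c / e)).+1.
  have HN : K + 1 + c / e < N%:R by apply: truncnS_gt.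
  have ce : 0 <= c / e by apply: divr_ge0 => //; apply: ltW.
  have N0 : 0 < N%:R :> R by apply: lt_le_trans (ltW HN); lra.
  have := H N ltac:(lra).
  have cN : c / N%:R <= e.
    rewrite ler_pdivrMr // mulrC -ler_pdivrMr //; lra.
  have -> : P 0 * Q 1 * (1 - (2 * K + K ^+ 2) / N%:R) = P 0 * Q 1 - c / N%:R.
    by rewrite /c; ring.
  lra.
move=> N HN.
have N0 : 0 < N%:R :> R by lra.
pose t (k : nat) : R := k%:R / N%:R.
have tin k : (k <= N)%N -> 0 <= t k <= 1.
  move=> kN; rewrite /t divr_ge0 //= ler_pdivrMr // mul1r ler_nat //.
pose hh : R := N%:R^-1.
have hh0 : 0 < hh by rewrite invr_gt0.
have tS k : t k.+1 - t k = hh by rewrite /t /hh -natr1; ring.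
(* Chosen so that 1 - e k = (1 + s (t k) h) (1 - s (t k.+1) h). Going one step forth and back with P
   alone shows that this product is at most 1, so e k >= 0 and the losses add up through (1 - E) (1
   - e) >= 1 - E - e. *)
pose e k := (s (t k.+1) - s (t k)) * hh + s (t k) * s (t k.+1) * hh ^+ 2.
have Kh : K * hh < 1.
  by rewrite /hh ltr_pdivrMr //; lra.
have step k : (k < N)%N -> [/\ 0 <= e k, 0 <= 1 - e k &
    P (t k) * Q (t k.+1) * (1 - e k) <= P (t k.+1) * Q (t k)].
  move=> kN; have a := tin _ (ltnW kN); have b := tin _ kN.
  have [Pa Qa Ka] := h _ a; have [Pb Qb Kb] := h _ b.
  have := hP _ _ a b; have := hP _ _ b a.
  have := hQ _ _ a b; have := hQ _ _ b a.
  have -> : t k - t k.+1 = - hh by rewrite -(tS k); ring.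
  rewrite tS.
  have Fa : 0 < 1 + s (t k) * hh.
    by move: Ka; rewrite ler_norml => /andP[? ?]; nra.
  have Fb : 0 < 1 + s (t k.+1) * - hh.
    by move: Kb; rewrite ler_norml => /andP[? ?]; nra.
  have ee : 1 - e k = (1 + s (t k) * hh) * (1 + s (t k.+1) * - hh).
    by rewrite /e; ring.
  move=> q1 q2 p1 p2; split.
  - have : P (t k) * (1 + s (t k) * hh) * (1 + s (t k.+1) * - hh) <= P (t k) * 1.
      by rewrite mulr1; apply: le_trans p1; rewrite ler_pM2r.
    by rewrite -mulrA -ee ler_pM2l //; lra.
  - by rewrite ee; apply: mulr_ge0; apply: ltW.
  - rewrite ee.
    have -> : P (t k) * Q (t k.+1) * ((1 + s (t k) * hh) * (1 + s (t k.+1) * - hh))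
     = (P (t k) * (1 + s (t k) * hh)) * (Q (t k.+1) * (1 + s (t k.+1) * - hh)) by ring.
    by apply: ler_pM => //; apply: mulr_ge0; apply: ltW.
have ind k : (k <= N)%N ->
    P 0 * Q (t k) * (1 - \sum_(j < k) e j) <= P (t k) * Q 0.
  elim: k => [|k IH] kN; first by rewrite big_ord0 /t mul0r subr0 mulr1.
  have {}IH := IH (ltnW kN); have [e0 e1 st] := step k kN.
  have [Pa Qa Ka] := h _ (tin _ (ltnW kN)); have [Pb Qb Kb] := h _ (tin _ kN).
  rewrite big_ord_recr /=; set E := \sum_(_ < k) _ in IH *.
  have E0 : 0 <= E.
    by apply: sumr_ge0 => j _; case: (step j (ltn_trans (ltn_ord j) kN)).
  rewrite -(ler_pM2l Qa).
  apply: (@le_trans _ _ (P 0 * Q (t k) * (1 - E) * (Q (t k.+1) * (1 - e k)))).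
    have -> : Q (t k) * (P 0 * Q (t k.+1) * (1 - (E + e k))) =
      P 0 * Q (t k) * Q (t k.+1) * (1 - E - e k) by ring.
    have -> : P 0 * Q (t k) * (1 - E) * (Q (t k.+1) * (1 - e k)) =
      P 0 * Q (t k) * Q (t k.+1) * ((1 - E) * (1 - e k)) by ring.
    rewrite ler_pM2l ?mulr_gt0 //; nra.
  apply: (@le_trans _ _ (P (t k) * Q 0 * (Q (t k.+1) * (1 - e k)))).
    by apply: ler_wpM2r => //; apply: mulr_ge0 => //; apply: ltW.
  have -> : P (t k) * Q 0 * (Q (t k.+1) * (1 - e k)) =
    (P (t k) * Q (t k.+1) * (1 - e k)) * Q 0 by ring.
  have -> : Q (t k) * (P (t k.+1) * Q 0) = P (t k.+1) * Q (t k) * Q 0 by ring.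
  by rewrite ler_pM2r.
have tel k : (k <= N)%N ->
    \sum_(j < k) e j <= (s (t k) - s (t 0%N)) * hh + k%:R * (K ^+ 2 * hh ^+ 2).
  elim: k => [|k IH] kN; first by rewrite big_ord0 subrr !mul0r addr0.
  rewrite big_ord_recr /=; have := IH (ltnW kN).
  have [_ _ Ka] := h _ (tin _ (ltnW kN)); have [_ _ Kb] := h _ (tin _ kN).
  have : s (t k) * s (t k.+1) * hh ^+ 2 <= K ^+ 2 * hh ^+ 2.
    apply: ler_wpM2r; first by apply: exprn_ge0; apply: ltW.
    by apply: le_trans (ler_norm _) _; rewrite normrM expr2 ler_pM.
  rewrite /e -natr1; lra.
have := ind N (leqnn N); have tN : t N = 1 by rewrite /t divff // gt_eqF.
rewrite tN; apply: le_trans; rewrite ler_pM2l ?mulr_gt0 // lerD2l lerN2.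
apply: le_trans (tel N (leqnn N)) _; rewrite tN /t mul0r.
have [_ _ Ka] := h 1 ltac:(lra).
move: K0 Ka; rewrite !ler_norml => /andP[? ?] /andP[? ?].
rewrite [leRHS]mulrDl; apply: lerD; first by apply: ler_wpM2r; [apply: ltW|lra].
by rewrite le_eqVlt; apply/orP; left; apply/eqP; rewrite /hh; field; rewrite gt_eqF.
Qed.

(** Replaces the extraction of a convergent subsequence: every closed condition that holds
    eventually passes to the cluster point v. *)
Lemma compact_cluster_seq (T : topologicalType) (A : set T) (u : nat -> T) :
  compact A -> (forall k, A (u k)) ->
  exists2 v, A v & forall F : set T, closed F ->
    (exists N, forall k, (N <= k)%N -> F (u k)) -> F v.
Proof.
move=> cA Au.
have uA : (u @ \oo) A by exists 0%N => // k _; exact: Au.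
have [v [Av clv]] := cA (u @ \oo) _ uA.
exists v => // F cF [N FN]; apply: cF => V Vv.
by apply: clv Vv; exists N => //= k; apply: FN.
Qed.

(** * Dot product and separation *)

Section Dot.
Variables (R : realType) (n : nat).
Implicit Types (x y a : 'rV[R]_n) (t : R).

Lemma dotrC x y : dotr x y = dotr y x.
Proof. by apply: eq_bigr => i _; rewrite mulrC. Qed.

Lemma dotrDr a x y : dotr a (x + y) = dotr a x + dotr a y.
Proof. by rewrite -big_split; apply: eq_bigr => i _; rewrite mxE mulrDr. Qed.

Lemma dotrZr a t x : dotr a (t *: x) = t * dotr a x.
Proof. by rewrite mulr_sumr; apply: eq_bigr => i _; rewrite mxE mulrCA. Qed.

Lemma dotrNr a x : dotr a (- x) = - dotr a x.
Proof. by rewrite -scaleN1r dotrZr mulN1r. Qed.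

Lemma dotrBr a x y : dotr a (x - y) = dotr a x - dotr a y.
Proof. by rewrite dotrDr dotrNr. Qed.

Lemma dotrDl a x y : dotr (x + y) a = dotr x a + dotr y a.
Proof. by rewrite !(dotrC _ a) dotrDr. Qed.

Lemma dotrZl a t x : dotr (t *: x) a = t * dotr x a.
Proof. by rewrite !(dotrC _ a) dotrZr. Qed.

Lemma dotrNl a x : dotr (- x) a = - dotr x a.
Proof. by rewrite !(dotrC _ a) dotrNr. Qed.

Lemma dotrBl a x y : dotr (x - y) a = dotr x a - dotr y a.
Proof. by rewrite dotrDl dotrNl. Qed.

Lemma dotr0 a : dotr a 0 = 0.
Proof. by rewrite -(scale0r 0) dotrZr mul0r. Qed.

Lemma dotr_sqB t x y :
  dotr (t *: x - y) (t *: x - y) = t ^+ 2 * dotr x x - 2 * t * dotr y x + dotr y y.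
Proof. by rewrite dotrBl !dotrBr !dotrZl !dotrZr (dotrC x y); ring. Qed.

Lemma dotrxx_ge0 x : 0 <= dotr x x.
Proof. by apply: sumr_ge0 => i _; rewrite -expr2 sqr_ge0. Qed.

Lemma dotrxx_eq0 x : (dotr x x == 0) = (x == 0).
Proof.
apply/idP/idP => [|/eqP->]; last by rewrite dotr0.
rewrite psumr_eq0 => [/allP h|i _]; last by rewrite -expr2 sqr_ge0.
apply/eqP/rowP => i; rewrite mxE; apply/eqP.
by have := h i (mem_index_enum i); rewrite /= mulf_eq0 orbb (_ : ord0 = 0).
Qed.

Lemma dotrxx_gt0 x : x != 0 -> 0 < dotr x x.
Proof. by rewrite lt_def dotrxx_ge0 dotrxx_eq0 andbT. Qed.

Lemma dotr_delta x (i : 'I_n) : dotr x (delta_mx 0 i) = x 0 i.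
Proof.
rewrite /dotr (bigD1 i) //= mxE !eqxx mulr1 big1 ?addr0 // => j ji.
by rewrite mxE (negbTE ji) andbF mulr0.
Qed.

Lemma coord_le_norm x (i : 'I_n) : `|x ord0 i| <= `|x|.
Proof. by rewrite [leRHS]mx_normrE; apply: (le_bigmax _ _ (ord0, i)). Qed.

Lemma dotr_le_norm a x : `|dotr a x| <= (\sum_i `|a ord0 i|) * `|x|.
Proof.
apply: le_trans (ler_norm_sum _ _ _) _; rewrite mulr_suml; apply: ler_sum => i _.
by rewrite normrM ler_wpM2l // coord_le_norm.
Qed.

Lemma dotrxx_ge_norm x : `|x| ^+ 2 <= dotr x x.
Proof.
have [x0|/mx_norm_neq0[[i j] e]] := eqVneq (mx_norm x) 0.
  by rewrite (mx_norm_eq0 x0) normr0 expr0n dotrxx_ge0.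
rewrite [X in X ^+ 2]e /= -normrX ger0_norm ?sqr_ge0 // (ord1 i) /dotr.
by rewrite (bigD1 j) //= -expr2 lerDl; apply: sumr_ge0 => k _; rewrite -expr2 sqr_ge0.
Qed.

End Dot.

Section Lipschitz.
Variables (R : realType) (V : normedModType R) (h : V -> R) (K : R).
Hypothesis hK : forall x y, h x - h y <= K * `|x - y|.

Lemma lipschitz_continuous_fun : continuous h.
Proof.
move=> x; apply/cvgrPdist_le => /= e e0.
have K1 : 0 < `|K| + 1 by rewrite ltr_wpDl.
near=> y.
have le : `|x - y| <= e / (`|K| + 1).
  by near: y; apply: (@cvgr_dist_le _ _ _ _ _ id) => //; apply: divr_gt0.
have le2 : K * `|x - y| <= e.
  apply: (@le_trans _ _ ((`|K| + 1) * `|x - y|)).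
    by apply: ler_wpM2r => //; have := ler_norm K; lra.
  by rewrite mulrC -ler_pdivlMr.
rewrite ler_norml; apply/andP; split; last exact: le_trans (hK _ _) le2.
by rewrite lerNl opprB; apply: le_trans (hK _ _) _; rewrite distrC.
Unshelve. all: by end_near. Qed.

Lemma lipschitz_closed_le c : closed [set x | h x <= c].
Proof.
rewrite (_ : [set x | _] = h @^-1` [set y | y <= c]) //.
by apply: closed_comp (@closed_le _ _) => x _; apply: lipschitz_continuous_fun.
Qed.

Lemma lipschitz_closed_eq c : closed [set x | h x = c].
Proof.
rewrite (_ : [set x | _] = h @^-1` [set y | y = c]) //.
by apply: closed_comp (@closed_eq _ _) => x _; apply: lipschitz_continuous_fun.
Qed.

End Lipschitz.

Section Separation.
Variables (R : realType) (n : nat).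
Implicit Types (C : set 'rV[R]_n) (x y z a p : 'rV[R]_n).

Lemma dotr_continuous a : continuous (fun x => dotr a x).
Proof.
apply: (@lipschitz_continuous_fun _ _ _ (\sum_i `|a ord0 i|)) => x y.
by rewrite -dotrBr; apply: (le_trans (ler_norm _)); exact: dotr_le_norm.
Qed.

Lemma dotr_closed_le a c : closed [set x | dotr x a <= c].
Proof.
apply: (@lipschitz_closed_le _ _ _ (\sum_i `|a ord0 i|)) => x y.
by rewrite !(dotrC _ a) -dotrBr; apply: (le_trans (ler_norm _)); exact: dotr_le_norm.
Qed.

Lemma dotr_closed_eq a c : closed [set x | dotr x a = c].
Proof.
apply: (@lipschitz_closed_eq _ _ _ (\sum_i `|a ord0 i|)) => x y.
by rewrite !(dotrC _ a) -dotrBr; apply: (le_trans (ler_norm _)); exact: dotr_le_norm.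
Qed.

Lemma dotrxx_continuous : continuous (fun x => dotr x x).
Proof.
rewrite /dotr; elim: (index_enum _) => [|i r IH] x.
  under eq_fun do rewrite big_nil.
  exact: cst_continuous.
rewrite (_ : (fun y => _) = (fun y : 'rV[R]_n => y ord0 i * y ord0 i) \+
    (fun y => \sum_(j <- r) y ord0 j * y ord0 j)); last first.
  by apply/funext => y; rewrite big_cons.
by apply: continuousD; [apply: continuousM; apply: coord_continuous|exact: IH].
Qed.

Lemma norm_bounded_compact (A : set 'rV[R]_n) (M : R) :
  (forall x, A x -> `|x| <= M) -> closed A -> compact A.
Proof.
move=> h cA; apply: bounded_closed_compact => //.
exists M; split; first exact: num_real.
by move=> N MN x Ax; apply: le_trans (h _ Ax) (ltW MN).
Qed.

Lemma nearest_point C y : closed C -> C !=set0 ->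
  exists2 p, C p & forall x, C x -> dotr (p - y) (p - y) <= dotr (x - y) (x - y).
Proof.
move=> cC [x0 Cx0]; pose e x := dotr (x - y) (x - y).
have ce : continuous e.
  move=> x; apply: (@continuous_comp _ _ _ (fun x => x - y) (fun x => dotr x x)).
    by apply: (@continuousB R _ _ id (fun=> y)); [exact: cvg_id|exact: cst_continuous].
  exact: dotrxx_continuous.
pose A := C `&` [set x | e x <= e x0].
have cA : compact A.
  apply: (@norm_bounded_compact _ (e x0 + 1 + `|y|)).
    move=> x [_ /= ex]; have : `|x - y| <= e x0 + 1.
      have := dotrxx_ge_norm (x - y); rewrite -/(e x) => h.
      have : 0 <= (`|x - y| - 1) ^+ 2 by exact: sqr_ge0.
      have := normr_ge0 (x - y); nra.
    by rewrite -{2}(subrK y x) => h; apply: le_trans (ler_normD _ _) _; rewrite lerD2r.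
  apply: closedI => //.
  rewrite (_ : [set x | _] = e @^-1` [set r | r <= e x0]) //.
  by apply: closed_comp (@closed_le _ _) => x _; apply: ce.
have [|p pA pmin] := @EVT_min_rV R n e A _ cA (continuous_subspaceT ce).
  by exists x0; split => //=.
move: pA; rewrite inE => -[Cp pe]; exists p => // x Cx.
have [xx0|/ltW xx0] := leP (e x) (e x0); last exact: le_trans pe xx0.
by apply: pmin; rewrite inE.
Qed.

Lemma convex_setP C : convex_set C <->
  (forall x y t, C x -> C y -> 0 <= t -> t <= 1 -> C (t *: x + (1 - t) *: y)).
Proof.
split=> [vC x y t Cx Cy t0 t1|vC x y t].
  by have := vC x y (Itv01 t0 t1); rewrite !inE; apply.
by rewrite !inE => Cx Cy; apply: vC.
Qed.

(** The derivative of |a + t x|^2 at t = 0 is 2 a.x. This optimality condition for nearest points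
    serves separation, smooth points and the parking of sets in ellipsoids. *)
Lemma dotr_ge0_of_expanding a x :
  (forall t, 0 < t -> t <= 1 -> dotr a a <= dotr (a + t *: x) (a + t *: x)) ->
  0 <= dotr a x.
Proof.
move=> h; rewrite leNgt; apply/negP => lt0.
set c := dotr a x in lt0; have d0 := dotrxx_ge0 x; set d := dotr x x in d0.
pose t := - c / (- c + d + 1).
have t0 : 0 < t by apply: divr_gt0; lra.
have t1 : t <= 1 by rewrite ler_pdivrMr; lra.
have := h t t0 t1; rewrite addrC -[X in _ + X]opprK dotr_sqB !dotrNl dotrNr opprK -/c -/d.
have tE : t * (- c + d + 1) = - c by rewrite /t divfK //; lra.
nra.
Qed.

Lemma separate_point C y : closed C -> convex_set C -> C !=set0 -> ~ C y ->
  exists2 a, a != 0 & forall x, C x -> dotr a x <= dotr a y.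
Proof.
move=> cC /convex_setP vC C0 nCy; have [p Cp pmin] := nearest_point y cC C0.
exists (y - p) => [|x Cx].
  by rewrite subr_eq0; apply/eqP => yp; apply: nCy; rewrite yp.
suff : 0 <= dotr (p - y) (x - p).
  have := dotrxx_ge0 (y - p).
  by rewrite -(opprB y p) dotrNl !(dotrBr (y - p) _ p); lra.
apply: dotr_ge0_of_expanding => t t0 t1.
have -> : p - y + t *: (x - p) = t *: x + (1 - t) *: p - y.
  by apply/rowP => i; rewrite !mxE; ring.
by apply: pmin; apply: vC => //; apply: ltW.
Qed.

Lemma sum_norm_le x : \sum_i `|x ord0 i| <= n%:R * `|x|.
Proof.
apply: (@le_trans _ _ (\sum_(i < n) `|x|)).
  by apply: ler_sum => i _; apply: coord_le_norm.
by rewrite sumr_const card_ord mulr_natl.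
Qed.

(** Normalised functionals separating C from outer points y -> z have a cluster point. The error n /
    (k + 1) bounds the product of y - z with a vector of sup norm 1. *)
Lemma supporting_functional C z : closed C -> convex_set C -> C !=set0 ->
  (forall e, 0 < e -> exists2 y, ~ C y & `|y - z| <= e) ->
  exists2 a, a != 0 & forall x, C x -> dotr a x <= dotr a z.
Proof.
move=> cC vC C0 hz.
have /choice[u hu] (k : nat) : exists a, `|a| = 1 /\
    forall x, C x -> dotr a x <= dotr a z + n%:R * k.+1%:R^-1.
  have [|y nCy yz] := hz k.+1%:R^-1; first by rewrite invr_gt0.
  have [a a0 ha] := separate_point cC vC C0 nCy.
  have na : 0 < `|a| by rewrite normr_gt0.
  exists (`|a|^-1 *: a); split.
    by rewrite normrZ normfV normr_id mulVf ?gt_eqF.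
  move=> x Cx; rewrite -lerBlDl -dotrBr.
  have -> : x - z = (x - y) + (y - z) by rewrite addrA subrK.
  rewrite dotrDr -[leRHS]add0r; apply: lerD.
    rewrite dotrZl dotrBr; apply: mulr_ge0_le0; first by rewrite invr_ge0.
    by rewrite subr_le0 ha.
  rewrite dotrC; apply: (le_trans (ler_norm _)); apply: (le_trans (dotr_le_norm _ _)).
  rewrite normrZ normfV normr_id mulVf ?gt_eqF // mulr1.
  by apply: (le_trans (sum_norm_le _)); apply: ler_wpM2l.
pose A := [set a : 'rV[R]_n | `|a| = 1].
have cA : compact A.
  apply: (@norm_bounded_compact _ 1); first by move=> x ->.
  apply: (@lipschitz_closed_eq _ _ _ 1) => x y; rewrite mul1r.
  exact: lerB_dist.
have [|a Aa ha] := compact_cluster_seq cA (u := u); first by move=> k; case: (hu k).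
exists a; first by rewrite -normr_gt0 Aa.
move=> x Cx; apply/ler_addgt0Pl => e e0.
rewrite -lerBlDr -dotrBr; apply: (ha [set a | dotr a (x - z) <= e]); first exact: dotr_closed_le.
exists (Num.truncn (n%:R / e)) => k hk; have [_ /(_ _ Cx) h] := hu k.
rewrite /= dotrBr; apply: (@le_trans _ _ (n%:R * k.+1%:R^-1)); first by rewrite lerBlDl.
rewrite ler_pdivrMr // mulrC -ler_pdivrMr //.
apply: ltW; apply: lt_le_trans (truncnS_gt _) _.
by rewrite ler_nat ltnS.
Qed.

End Separation.

(** * Gauges *)

(* Gauges of compact convex neighbourhoods of 0; evenness is a separate hypothesis. *)
Definition sublinear (R : realType) (n : nat) (g : 'rV[R]_n -> R) : Prop :=
  [/\ forall x y, g (x + y) <= g x + g y,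
      forall t x, 0 <= t -> g (t *: x) = t * g x,
      exists2 c, 0 < c & forall x, c * `|x| <= g x &
      exists C, forall x, g x <= C * `|x| ].

Section Gauge.
Variables (R : realType) (n : nat).
Implicit Types (B C : set 'rV[R]_n) (x y z v : 'rV[R]_n).

Lemma closed_approx C z : closed C ->
  (forall e, 0 < e -> exists2 y, C y & `|y - z| <= e) -> C z.
Proof.
move=> cC h; apply: cC => V /nbhs_ballP[e /= e0 eV].
have [|y Cy yz] := h (e / 2); first by rewrite divr_gt0.
exists y; split => //; apply: eV; rewrite -ball_normE /= distrC.
by apply: le_lt_trans yz _; rewrite ltr_pdivrMr // ltr_pMr // ltr1n.
Qed.

Lemma scaled_mem B t x : convex_set B -> B 0 -> B x -> 0 <= t <= 1 -> B (t *: x).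
Proof.
move=> /convex_setP vB B0 Bx /andP[t0 t1].
by have := vB _ _ _ Bx B0 t0 t1; rewrite scaler0 addr0.
Qed.

(** The Minkowski functional of B: a ball inside B bounds it above by a multiple of the norm,
    boundedness of B bounds it below. *)
Lemma exists_gauge B : compact B -> convex_set B -> interior B 0 ->
  exists2 g, sublinear g & forall x, B x <-> g x <= 1.
Proof.
move=> cB vB iB.
have clB : closed B by apply: compact_closed cB; apply: norm_hausdorff.
have B0 : B 0 by apply: nbhs_singleton.
have [r r0 rB] : exists2 r, 0 < r & forall x, `|x| <= r -> B x.
  move/nbhs_ballP: iB => [e /= e0 eB]; exists (e / 2); first by rewrite divr_gt0.
  move=> x xe; apply: eB; rewrite -ball_normE /= sub0r normrN.
  by apply: le_lt_trans xe _; rewrite ltr_pdivrMr // ltr_pMr // ltr1n.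
have [M M0 BM] : exists2 M, 0 < M & forall x, B x -> `|x| <= M.
  have [M [Mr hM]] := compact_bounded cB.
  exists (Num.max (M + 1) 1); first by rewrite lt_max ltr01 orbT.
  by move=> x Bx; apply: hM => //; rewrite lt_max ltrDl ltr01.
pose S x := [set t | 0 < t /\ B (t^-1 *: x)].
pose g x := inf (S x).
have lbS x : lbound (S x) 0 by move=> t [/ltW].
have S0 x : S x !=set0.
  exists ((`|x| + 1) / r); have x1 : 0 < `|x| + 1 by rewrite ltr_wpDl.
  split; first by rewrite divr_gt0.
  apply: rB; rewrite normrZ invf_div normrM (ger0_norm (ltW r0)) normfV.
  rewrite (ger0_norm (ltW x1)) mulrAC ler_pdivrMr // ler_pM2l //; lra.
have g_ge0 x : 0 <= g x by apply: lb_le_inf.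
have g_le (t : R) x : 0 < t -> B (t^-1 *: x) -> g x <= t.
  by move=> t0 Bt; apply: ge_inf; [exists 0|split].
have g_lt (t : R) x : g x < t -> B (t^-1 *: x).
  move=> gt; have [s [s0 Bs] st] := inf_lt (S0 x) gt.
  rewrite (_ : t^-1 *: x = (s / t) *: (s^-1 *: x)).
    apply: scaled_mem => //; rewrite divr_ge0 ?ler_pdivrMr ?mul1r ?ltW //=.
      exact: lt_trans st.
    exact: lt_trans st.
  by rewrite scalerA mulrAC divff ?mul1r // gt_eqF.
have gZ_le (t : R) x : 0 < t -> g (t *: x) <= t * g x.
  move=> t0; rewrite -ler_pdivrMl //; apply/ler_addgt0Pl => e e0.
  rewrite ler_pdivrMl //; apply: g_le; first by apply: mulr_gt0 => //; have := g_ge0 x; lra.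
  rewrite scalerA invfM mulrAC mulVf ?gt_eqF // mul1r; apply: g_lt; lra.
have gZ (t : R) x : 0 < t -> g (t *: x) = t * g x.
  move=> t0; apply/eqP; rewrite eq_le gZ_le //=.
  have := @gZ_le t^-1 (t *: x); rewrite invr_gt0 scalerA mulVf ?gt_eqF // scale1r.
  by move=> /(_ t0); rewrite ler_pdivlMl.
have g0 : g 0 = 0.
  apply/eqP; rewrite eq_le g_ge0 andbT; apply/ler_addgt0Pl => e e0.
  by rewrite addr0; apply: g_le => //; rewrite scaler0.
exists g; first split.
- move=> x y; apply/ler_addgt0Pl => e e0.
  have gx := g_ge0 x; have gy := g_ge0 y.
  pose s := g x + e / 2; pose t := g y + e / 2.
  have s0 : 0 < s by rewrite /s; lra.
  have t0 : 0 < t by rewrite /t; lra.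
  have st : 0 < s + t by lra.
  have Bs : B (s^-1 *: x) by apply: g_lt; rewrite /s; lra.
  have Bt : B (t^-1 *: y) by apply: g_lt; rewrite /t; lra.
  have -> : e + (g x + g y) = s + t by rewrite /s /t; lra.
  apply: g_le => //; move/convex_setP: vB => /(_ _ _ (s / (s + t)) Bs Bt).
  rewrite ler_pdivrMr // mul1r => /(_ ltac:(by apply: divr_ge0; lra) ltac:(lra)).
  congr B; apply/rowP => i; rewrite !mxE; field; by rewrite !gt_eqF.
- move=> t x; rewrite le_eqVlt => /predU1P[<-|]; last exact: gZ.
  by rewrite scale0r mul0r.
- exists M^-1; first by rewrite invr_gt0.
  move=> x; apply: lb_le_inf => // t [t0 /BM].
  by rewrite normrZ normfV gtr0_norm // !ler_pdivrMl // mulrC.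
- exists r^-1 => x; have [->|x0] := eqVneq x 0; first by rewrite g0 normr0 mulr0.
  have nx : 0 < `|x| by rewrite normr_gt0.
  apply: g_le; first by apply: mulr_gt0; rewrite ?invr_gt0.
  apply: rB; rewrite normrZ invfM invrK normrM normfV normr_id (gtr0_norm r0).
  by rewrite mulfVK ?gt_eqF.
move=> x; split=> [Bx|gx]; first by apply: g_le => //; rewrite invr1 scale1r.
(* The infimum need not be attained a priori: only g x < t puts x / t into B, so x is approached by
   the points x / (1 + d). *)
apply: closed_approx => // e e0; pose d := e / (`|x| + 1).
have x1 : 0 < `|x| + 1 by rewrite ltr_wpDl.
have d0 : 0 < d by apply: divr_gt0.
exists ((1 + d)^-1 *: x); first by apply: g_lt; lra.
rewrite -{2}[x]scale1r -scalerBl normrZ.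
have -> : (1 + d)^-1 - 1 = - (d / (1 + d)) by field; rewrite gt_eqF //; lra.
rewrite normrN ger0_norm; last by apply: divr_ge0; lra.
have dd : d / (1 + d) <= d by rewrite ler_pdivrMr; nra.
apply: (@le_trans _ _ (d * (`|x| + 1))); last by rewrite /d divfK // gt_eqF.
by apply: ler_pM => //; [apply: divr_ge0; lra|lra].
Qed.

End Gauge.

(** * Projections of norm one *)

Section Norm.
Variables (R : realType) (n : nat) (g : 'rV[R]_n -> R).
Hypotheses (gS : sublinear g) (gN : forall x, g (- x) = g x).
Implicit Types (x y z v w a b c d : 'rV[R]_n) (s t e : R) (S : set 'rV[R]_n).

Lemma norm_triangle x y : g (x + y) <= g x + g y.
Proof. by case: gS. Qed.

Lemma norm_scale t x : g (t *: x) = `|t| * g x.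
Proof.
have [_ gZ _ _] := gS; have [t0|t0] := leP 0 t; first by rewrite gZ ?ger0_norm.
by rewrite -gN -scaleNr gZ ?ltr0_norm // oppr_ge0 ltW.
Qed.

Lemma norm_dist x y : g x - g y <= g (x - y).
Proof. by rewrite lerBlDr -{1}(subrK y x) norm_triangle. Qed.

Lemma norm_gt0 x : x != 0 -> 0 < g x.
Proof.
have [_ _ [c c0 gc] _] := gS => x0.
by apply: lt_le_trans (gc x); apply: mulr_gt0; rewrite ?normr_gt0.
Qed.

Lemma norm_0 : g 0 = 0.
Proof. by have := norm_scale 0 0; rewrite scale0r normr0 mul0r. Qed.

Lemma norm_ge0 x : 0 <= g x.
Proof.
have [->|/norm_gt0/ltW//] := eqVneq x 0.
by rewrite norm_0.
Qed.

Lemma norm_affine_closed_le x t e : closed [set v | g (x - t *: v) <= e].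
Proof.
have [_ _ _ [C gC]] := gS.
suff h (u v : 'rV[R]_n) : g (x - t *: u) - g (x - t *: v) <= `|t| * C * `|u - v|.
  exact: (@lipschitz_closed_le _ _ (fun v => g (x - t *: v)) _ h).
apply: le_trans (norm_dist _ _) _.
have -> : x - t *: u - (x - t *: v) = (- t) *: (u - v).
  by apply/rowP => i; rewrite !mxE; ring.
by rewrite norm_scale normrN -mulrA; apply: ler_wpM2l.
Qed.

Lemma dotr_le_gauge a : exists2 A, 0 <= A & forall x, `|dotr a x| <= A * g x.
Proof.
have [_ _ [c c0 gc] _] := gS.
exists ((\sum_i `|a ord0 i|) / c); first by apply: divr_ge0; [apply: sumr_ge0|apply: ltW].
move=> x; apply: (le_trans (dotr_le_norm _ _)).
rewrite mulrAC -mulrA; apply: ler_wpM2l; first exact: sumr_ge0.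
by rewrite ler_pdivlMr // mulrC.
Qed.

(** The map x |-> x - (a.x) v is the projection of S along v onto the kernel of a in S; the last
    clause says that it has norm at most one. *)
Definition complemented S : Prop := forall a, (exists2 x, S x & dotr a x != 0) ->
  exists v, [/\ S v, dotr a v = 1 & forall x, S x -> g (x - dotr a x *: v) <= g x].

Definition linear_set S : Prop := forall t x y, S x -> S y -> S (t *: x + y).

Let projects S a v :=
  [/\ S v, dotr a v = 1 & forall x, S x -> g (x - dotr a x *: v) <= g x].

(** The vector (a.x) v is the difference of x and its projection, both of gauge at most g x. This
    confines the directions v to a compact set. *)
Let projects_bound S a v x : projects S a v -> S x -> `|dotr a x| * g v <= 2 * g x.
Proof.
move=> [_ _ h] Sx; rewrite -norm_scale.
have := norm_dist (dotr a x *: v) x; have := h x Sx.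
rewrite -(gN (_ - x)) opprB; lra.
Qed.

(** Closedness in the parameter s, needed at the supremum in [complemented_section], once for b' = b
    and once for b' = - b. A vector of S killed by b but not by c bounds the directions uniformly in
    s. *)
Let projects_limit S b c s b' : closed S ->
  (exists2 x, S x & [/\ dotr b x = 0 & dotr c x != 0]) ->
  (forall e, 0 < e -> exists s' v, [/\ `|s' - s| <= e, projects S (c + s' *: b) v &
     dotr v b' <= 0]) ->
  exists2 v, projects S (c + s *: b) v & dotr v b' <= 0.
Proof.
move=> cS [x1 Sx1 [bx1 cx1]] h.
have /choice[u hu] (k : nat) : exists u : R * 'rV[R]_n,
   [/\ `|u.1 - s| <= k.+1%:R^-1, projects S (c + u.1 *: b) u.2 & dotr u.2 b' <= 0].
  by have [|s' [v ?]] := h k.+1%:R^-1; [rewrite invr_gt0|exists (s', v)].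
pose M := 2 * g x1 / `|dotr c x1|.
have ncx1 : 0 < `|dotr c x1| by rewrite normr_gt0.
have uM k : g (u k).2 <= M.
  have [_ /projects_bound/(_ Sx1) + _] := hu k.
  by rewrite dotrDl dotrZl bx1 mulr0 addr0 /M ler_pdivlMr // mulrC.
have M0 : 0 <= M by apply: le_trans (uM 0%N); apply: norm_ge0.
have [_ _ [c0 c00 gc] _] := gS.
pose A := [set v : 'rV[R]_n | `|v| <= M / c0].
have cA : compact A.
  apply: (@norm_bounded_compact _ _ _ (M / c0)) => //.
  apply: (@lipschitz_closed_le _ _ _ 1) => x y; rewrite mul1r.
  exact: lerB_dist.
have [|v Av hv] := @compact_cluster_seq _ A (fun k => (u k).2) cA.
  by move=> k; rewrite /A /= ler_pdivlMr // mulrC; apply: le_trans (uM k).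
have [B B0 hB] := dotr_le_gauge b.
have small e (D : R) : 0 < e -> 0 <= D ->
    exists N, forall k, (N <= k)%N -> `|(u k).1 - s| * D <= e.
  move=> e0 D0; exists (Num.truncn (D / e)) => k hk; have [uk _ _] := hu k.
  apply: (@le_trans _ _ (k.+1%:R^-1 * D)); first exact: ler_wpM2r.
  rewrite ler_pdivrMl // mulrC -ler_pdivrMl // mulrC.
  by apply: ltW; apply: lt_le_trans (truncnS_gt _) _; rewrite ler_nat ltnS.
have bM k : `|dotr b (u k).2| <= B * M.
  by apply: le_trans (hB _) _; apply: ler_wpM2l.
have BM0 : 0 <= B * M by apply: mulr_ge0.
have key k : `|dotr (u k).2 (c + s *: b) - 1| <= `|(u k).1 - s| * (B * M).
  have [_ [_ e1 _] _] := hu k.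
  rewrite -e1 (dotrC (u k).2) !dotrDl !dotrZl opprD addrACA subrr add0r -mulrBl.
  by rewrite normrM distrC; apply: ler_wpM2l.
exists v; last first.
  apply: (hv [set v | dotr v b' <= 0]); first exact: dotr_closed_le.
  by exists 0%N => k _; case: (hu k).
split.
- by apply: (hv S) => //; exists 0%N => k _; case: (hu k) => _ [].
- rewrite dotrC; apply/eqP; rewrite eq_le; apply/andP; split.
    apply/ler_addgt0Pl => e e0; apply: (hv [set v | dotr v (c + s *: b) <= e + 1]).
      exact: dotr_closed_le.
    have [N hN] := small e _ e0 BM0; exists N => k /hN le /=.
    by rewrite -lerBlDr; apply: le_trans le; apply: (le_trans _ (key k)); exact: ler_norm.
  rewrite -lerN2 -dotrNr; apply/ler_addgt0Pl => e e0.
  apply: (hv [set v | dotr v (- (c + s *: b)) <= e - 1]); first exact: dotr_closed_le.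
  have [N hN] := small e _ e0 BM0; exists N => k /hN le /=.
  have := le_trans (key k) le; rewrite ler_norml dotrNr => /andP[]; lra.
- move=> x Sx; apply/ler_addgt0Pl => e e0.
  apply: (hv [set v | g (x - dotr (c + s *: b) x *: v) <= e + g x]).
    exact: norm_affine_closed_le.
  have bxM : 0 <= `|dotr b x| * M by apply: mulr_ge0.
  have [N hN] := small e _ e0 bxM; exists N => k /hN le /=.
  have [_ [_ _ /(_ _ Sx) h1] _] := hu k.
  have -> : x - dotr (c + s *: b) x *: (u k).2 =
      (((u k).1 - s) * dotr b x) *: (u k).2 + (x - dotr (c + (u k).1 *: b) x *: (u k).2).
    by rewrite !dotrDl !dotrZl; apply/rowP => i; rewrite !mxE; ring.
  apply: le_trans (norm_triangle _ _) _; apply: lerD => //.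
  rewrite norm_scale normrM -mulrA; apply: le_trans le.
  by apply: ler_wpM2l => //; apply: ler_wpM2l.
Qed.

(* Among the projections along the functionals c + s b, the value of b on the direction
   of projection is positive for large s and negative for large -s. The directions
   allowed for a given s form a compact convex set, so b vanishes on one of them for
   some s; there c + s b and c agree on the kernel of b. *)
Lemma complemented_section S b : closed S -> linear_set S -> complemented S ->
  complemented (S `&` [set x | dotr b x = 0]).
Proof.
move=> cS lS kS c [x1 [Sx1 /= bx1] cx1].
have [Sb|] := pselect (forall x, S x -> dotr b x = 0).
  have [|v [Sv cv hv]] := kS c; first by exists x1.
  by exists v; split => [|//|x [Sx _]]; [split => //; exact: Sb|exact: hv].
move=> /existsNP[x2' /not_implyP[Sx2' /eqP bx2']].
have S0 : S 0 by have := lS (-1) _ _ Sx1 Sx1; rewrite scaleN1r addNr.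
have SZ t x : S x -> S (t *: x) by move=> Sx; rewrite -[_ *: _]addr0; apply: lS.
pose x2 := (dotr b x2')^-1 *: x2'.
have Sx2 : S x2 by exact: SZ.
have bx2 : dotr b x2 = 1 by rewrite dotrZr mulVf.
have hV s : exists v, projects S (c + s *: b) v.
  by apply: kS; exists x1; rewrite // dotrDl dotrZl bx1 mulr0 addr0.
have [A A0 hA] := dotr_le_gauge c.
(* For |s| >= T the projection bound at x2 gives A g v < 1, so |c.v| < 1 and s (b.v) = 1 - c.v is
   positive. *)
pose T := 2 * A * g x2 + `|dotr c x2| + 1.
have gx2 := norm_ge0 x2.
have Ag : 0 <= 2 * A * g x2 by apply: mulr_ge0 => //; lra.
have T0 : 0 < T by rewrite /T; have := normr_ge0 (dotr c x2); lra.
have big s v : T <= `|s| -> projects S (c + s *: b) v -> 0 < s * dotr b v.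
  move=> Ts pv; have := projects_bound pv Sx2; case: pv => _ + _.
  rewrite !dotrDl !dotrZl bx2 mulr1 => e1 le.
  have : 2 * A * g x2 + 1 <= `|dotr c x2 + s|.
    have := lerB_normD s (dotr c x2); rewrite (addrC s) /T in Ts *; lra.
  move=> le2; have gv := norm_ge0 v.
  have : (2 * A * g x2 + 1) * (A * g v) <= A * (2 * g x2).
    apply: (@le_trans _ _ (`|dotr c x2 + s| * (A * g v))).
      by apply: ler_wpM2r => //; apply: mulr_ge0.
    by rewrite mulrCA; apply: ler_wpM2l.
  move=> le3; have Agv : A * g v < 1.
    rewrite ltNge; apply/negP => ge1; have : 2 * A * g x2 + 1 <= A * (2 * g x2).
      by apply: le_trans le3; rewrite ler_peMr //; lra.
    lra.
  have := le_lt_trans (ler_norm _) (le_lt_trans (hA v) Agv); lra.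
pose E := [set s | exists2 v, projects S (c + s *: b) v & dotr v b <= 0].
have ET : ubound E T.
  move=> s [v pv bv]; rewrite leNgt; apply/negP => Ts.
  have s0 : 0 < s by lra.
  have := big s v; rewrite (gtr0_norm s0) => /(_ (ltW Ts) pv).
  by rewrite pmulr_rgt0 // dotrC ltNge bv.
have E0 : E !=set0.
  exists (- T); have [v pv] := hV (- T); exists v => //.
  have := big (- T) v; rewrite normrN (gtr0_norm T0) => /(_ (lexx _) pv).
  by rewrite dotrC; nra.
have hE : has_sup E by split => //; exists T.
(* Each interval (s - e, s] contains a parameter with a direction where b <= 0, while beyond s every
   direction has b > 0. The limits from both sides give v1 and v2, directions for the same s on
   which b has opposite signs. *)
pose s := sup E.
have xx : exists2 x, S x & [/\ dotr b x = 0 & dotr c x != 0] by exists x1.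
have [e e0|v1 pv1 bv1] := @projects_limit S b c s b cS xx.
  have [s' [v pv bv] ss'] := sup_adherent e0 hE.
  exists s', v; split => //; rewrite ler_norml; apply/andP; split; first by rewrite /s; lra.
  have : s' <= s by apply: ub_le_sup; [exists T|exists v].
  lra.
have [e e0|v2 pv2 bv2] := @projects_limit S b c s (- b) cS xx.
  have [v pv] := hV (s + e); exists (s + e), v; split => //.
    by rewrite addrAC subrr add0r gtr0_norm.
  rewrite dotrNr oppr_le0 leNgt; apply/negP => bv.
  have : s + e <= s by apply: ub_le_sup; [exists T|exists v => //; apply: ltW].
  lra.
rewrite dotrNr oppr_le0 in bv2.
suff [v pv bv] : exists2 v, projects S (c + s *: b) v & dotr b v = 0.
  have [Sv e1 hv] := pv; exists v; split => //.
    by move: e1; rewrite dotrDl dotrZl bv mulr0 addr0.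
  by move=> x [Sx /= bx]; have := hv x Sx; rewrite dotrDl dotrZl bx mulr0 addr0.
have [b1|b1] := eqVneq (dotr v1 b) 0; first by exists v1; rewrite // dotrC.
have {}bv1 : dotr v1 b < 0 by rewrite lt_neqAle b1.
pose t := dotr v2 b / (dotr v2 b - dotr v1 b).
have d0 : 0 < dotr v2 b - dotr v1 b by lra.
have t0 : 0 <= t by apply: divr_ge0 => //; apply: ltW.
have t1 : t <= 1 by rewrite ler_pdivrMr //; lra.
have [Sv1 e1 h1] := pv1; have [Sv2 e2 h2] := pv2.
exists (t *: v1 + (1 - t) *: v2); last first.
  rewrite dotrC dotrDl !dotrZl /t; field; rewrite gt_eqF //.
split; first by apply: lS => //; apply: SZ.
  by rewrite dotrDr !dotrZr e1 e2; ring.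
move=> x Sx; set k := dotr _ _.
have -> : x - k *: (t *: v1 + (1 - t) *: v2) =
    t *: (x - k *: v1) + (1 - t) *: (x - k *: v2).
  by apply/rowP => i; rewrite !mxE; ring.
apply: le_trans (norm_triangle _ _) _; rewrite !norm_scale !ger0_norm ?subr_ge0 //.
have := ler_wpM2l t0 (h1 x Sx).
have t1' : 0 <= 1 - t by lra.
have := ler_wpM2l t1' (h2 x Sx).
rewrite -/k; lra.
Qed.

Definition common_kernel (l : seq 'rV[R]_n) : set 'rV[R]_n :=
  [set x | forall b, b \in l -> dotr b x = 0].

Lemma complemented_common_kernel l : complemented setT -> complemented (common_kernel l).
Proof.
move=> kT; elim: l => [|b l IH].
  by rewrite (_ : common_kernel _ = setT) //; apply/seteqP; split.
have -> : common_kernel (b :: l) = common_kernel l `&` [set x | dotr b x = 0].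
  apply/seteqP; split=> x.
    by move=> h; split=> [c cl|/=]; apply: h; rewrite inE ?cl ?eqxx ?orbT.
  by move=> [h /= bx] c; rewrite inE => /predU1P[->|/h].
apply: complemented_section => //.
  have -> : common_kernel l = \bigcap_(b in [set b | b \in l]) [set x | dotr x b = 0].
    by apply/seteqP; split=> x h c /= cl; have := h c cl; rewrite /= dotrC.
  by apply: closed_bigI => c _; apply: dotr_closed_eq.
by move=> t x y hx hy c cl; rewrite dotrDr dotrZr hx // hy // mulr0 addr0.
Qed.

End Norm.

(** * Reflections at smooth points *)

Section LinearAlgebra.
Variables (R : realType) (n : nat).
Implicit Types (x y z v w a b d : 'rV[R]_n).

(** The columns of [cokermx W] are functionals cutting out the row space of W; a span thus gets the
    form treated by [complemented_common_kernel]. *)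
Lemma span_common_kernel m (W : 'M[R]_(m, n)) :
  exists l, forall x, common_kernel l x <-> (x <= W)%MS.
Proof.
pose row_of (j : 'I_n) := (col j (cokermx W))^T.
have dotE x j : dotr (row_of j) x = (x *m cokermx W) ord0 j.
  by rewrite mxE; apply: eq_bigr => i _; rewrite !mxE mulrC.
exists [seq row_of j | j <- enum 'I_n] => x; split.
  move=> h; rewrite submxE; apply/eqP/rowP => j; rewrite [RHS]mxE -dotE.
  by apply: h; apply: map_f; rewrite mem_enum.
by rewrite submxE => /eqP h b /mapP[j _ ->]; rewrite dotE h mxE.
Qed.

Lemma sub_span2P x w z :
  reflect (exists p q : R, z = p *: x + q *: w) (z <= x + w)%MS.
Proof.
apply: (iffP sub_addsmxP) => [[[p q] ->]|[p [q ->]]].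
  exists (p ord0 ord0), (q ord0 ord0).
  by rewrite /= {1}[p]mx11_scalar {1}[q]mx11_scalar !mul_scalar_mx.
by exists (p%:M, q%:M); rewrite /= !mul_scalar_mx.
Qed.

Lemma span2_functional x w d : ~~ (d <= x + w)%MS ->
  exists a, [/\ dotr a x = 0, dotr a w = 0 & dotr a d != 0].
Proof.
have [l hl] := span_common_kernel (x + w)%MS.
move=> /negP; rewrite -hl => /existsNP[a /not_implyP[al /eqP ad]].
exists a; split=> //.
  by have /hl/(_ a al) := addsmxSl x w.
by have /hl/(_ a al) := addsmxSr x w.
Qed.

Lemma exists_left_kernel k (A : 'M[R]_(n, k)) : (k < n)%N ->
  exists2 x : 'rV[R]_n, x != 0 & x *m A = 0.
Proof.
move=> kn; exists (nz_row (kermx A)).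
  by rewrite nz_row_eq0 -mxrank_eq0 mxrank_ker subn_eq0 -ltnNge (leq_ltn_trans (rank_leq_col A)).
by apply/sub_kermxP; apply: nz_row_sub.
Qed.

Lemma exists_orthogonal2 a b : (2 < n)%N ->
  exists z, [/\ z != 0, dotr a z = 0 & dotr b z = 0].
Proof.
move=> n2; have [z z0 hz] := exists_left_kernel (row_mx a^T b^T) n2.
have dE c : (z *m c^T) 0 0 = dotr c z.
  by rewrite mxE; apply: eq_bigr => i _; rewrite mxE mulrC.
move: hz; rewrite mul_mx_row -row_mx0 => /eq_row_mx[ha hb].
by exists z; split => //; rewrite -dE ?ha ?hb mxE.
Qed.

(** Supplies the bound K of [proportional_subgradients]: relative subgradients are bounded by the
    gauge of the step d over m. *)
Lemma segment_lower_bound (g : 'rV[R]_n -> R) w0 d : sublinear g ->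
  (forall t, 0 <= t <= 1 -> w0 + t *: d != 0) ->
  exists2 m, 0 < m & forall t, 0 <= t <= 1 -> m <= g (w0 + t *: d).
Proof.
move=> [_ _ [c c0 gc] _] h.
have cf : continuous (fun t : R => `|w0 + t *: d|).
  apply: (@lipschitz_continuous_fun _ _ _ `|d|) => s t.
  apply: (le_trans (lerB_dist _ _)).
  by rewrite opprD addrACA subrr add0r -scalerBl normrZ mulrC.
have [t + ht] := @EVT_min R _ 0 1 ler01 (continuous_subspaceT cf).
rewrite in_itv /= => t01.
exists (c * `|w0 + t *: d|); first by apply: mulr_gt0 => //; rewrite normr_gt0 h.
move=> s s01; apply: le_trans (gc _); rewrite ler_pM2l //.
by apply: ht; rewrite in_itv.
Qed.

End LinearAlgebra.

(** * Homothetic level sets on a tangent hyperplane *)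

Section Level.
Variables (R : realType) (n : nat) (g : 'rV[R]_n -> R).
Hypotheses (gS : sublinear g) (gN : forall x, g (- x) = g x).
Implicit Types (x y z v w a b d : 'rV[R]_n).

(** Take a functional a that vanishes on x and w but not on d, and project the span of the three
    along v: the plane of x and w is Birkhoff orthogonal to v. Since a.v = 1, v has a nonzero
    d-component. *)
Lemma complemented_span3 x w d : complemented g setT -> ~~ (d <= x + w)%MS ->
  exists v, (exists p q r, [/\ v = p *: x + q *: w + r *: d & r != 0]) /\
    forall p q s, g (p *: x + q *: w) <= g (p *: x + q *: w + s *: v).
Proof.
move=> kT nd; have [a [ax aw ad]] := span2_functional nd.
have [l hl] := span_common_kernel (x + w + d)%MS.
have [|v [/hl Sv av hv]] := complemented_common_kernel gS gN (l := l) kT (a := a).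
  by exists d => //; apply/hl; apply: addsmxSr.
exists v; split.
  move: Sv => /sub_addsmxP[[u r] /= ev].
  have /sub_span2P[p [q e]] : (u *m (x + w)%MS <= x + w)%MS by apply: submxMl.
  move: ev; rewrite e [r]mx11_scalar mul_scalar_mx => ev.
  exists p, q, (r 0 0); split => //; apply/eqP => r0; move: av.
  by rewrite ev r0 scale0r addr0 dotrDr !dotrZr ax aw !mulr0 addr0 => /esym/eqP; rewrite oner_eq0.
move=> p q s; set z := _ + _.
have Sz : common_kernel l (z + s *: v).
  apply/hl; apply: addmx_sub; last exact: scalemx_sub.
  by apply: submx_trans (addsmxSl _ _); apply/sub_span2P; exists p, q.
have := hv _ Sz; have -> : dotr a (z + s *: v) = s.
  by rewrite !dotrDr !dotrZr ax aw av; ring.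
by rewrite addrK.
Qed.

Section Root.
Variables (x : 'rV[R]_n) (c : R).
Hypothesis xc : g x < c.

(** As g x < c, the function r |-> g (r x + z) - c r is strictly decreasing, so its zero r bounds
    every s where it is nonnegative. *)
Lemma level_root_le (r s : R) z : g (r *: x + z) = c * r -> c * s <= g (s *: x + z) -> s <= r.
Proof.
move=> hr hs; rewrite leNgt; apply/negP => rs.
have := norm_triangle gS ((s - r) *: x) (r *: x + z).
rewrite addrA -scalerDl subrK (norm_scale gS gN) hr gtr0_norm ?subr_gt0 //.
have : 0 < (s - r) * (c - g x) by rewrite mulr_gt0 ?subr_gt0.
lra.
Qed.

(* L is the gauge of the level set { z | g (x + z) <= c }. *)
Lemma exists_level_root : exists L : 'rV[R]_n -> R,
  forall z, z != 0 -> 0 < L z /\ g (L z *: x + z) = c * L z.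
Proof.
suff h z : exists r, z != 0 -> 0 < r /\ g (r *: x + z) = c * r.
  by have [L hL] := choice h; exists L.
have [->|z0] := eqVneq z 0; first by exists 0.
have gz : 0 < g z by exact: norm_gt0.
have gx : 0 <= g x by exact: norm_ge0.
have xc' := xc.
pose h r := g (r *: x + z) - c * r.
have ch : continuous h.
  apply: (@lipschitz_continuous_fun _ _ _ (g x + c)) => s t.
  rewrite /h; have := norm_dist gS (s *: x + z) (t *: x + z).
  have -> : s *: x + z - (t *: x + z) = (s - t) *: x.
    by apply/rowP => i; rewrite !mxE; ring.
  rewrite (norm_scale gS gN).
  have : c * (t - s) <= c * `|s - t|.
    by apply: ler_wpM2l; [lra|rewrite distrC; apply: ler_norm].
  lra.
(* T solves T g x + g z = c T, so the triangle inequality makes [h] nonpositive there. *)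
pose T := g z / (c - g x).
have T0 : 0 < T by apply: divr_gt0 => //; lra.
have hT : h T <= 0.
  rewrite /h; have := norm_triangle gS (T *: x) z; rewrite (norm_scale gS gN) gtr0_norm //.
  have : T * (c - g x) = g z by rewrite /T divfK // gt_eqF //; lra.
  lra.
have h0 : 0 < h 0 by rewrite /h scale0r add0r mulr0 subr0.
have [|r] := @IVT R h 0 T 0 (ltW T0) (continuous_subspaceT ch).
  by rewrite ge_min hT orbT le_max (ltW h0).
rewrite in_itv /= => /andP[r0 _] hr.
exists r => _; split; last by move: hr; rewrite /h; lra.
by rewrite lt_neqAle r0 andbT; apply/eqP => e; rewrite -e in hr; rewrite hr ltxx in h0.
Qed.

End Root.

(* At each w, the projection onto the plane through x and w provides a common support
   of g and of the level gauge L. *)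
Lemma level_ratio x f c L w0 w1 : complemented g setT -> dotr f x = 1 ->
  (forall v, (forall s, g x <= g (x + s *: v)) -> dotr f v = 0) ->
  g x < c -> (forall z, z != 0 -> 0 < L z /\ g (L z *: x + z) = c * L z) ->
  dotr f w0 = 0 -> dotr f w1 = 0 ->
  (forall p q, p *: w0 + q *: w1 = 0 -> p = 0 /\ q = 0) ->
  L w1 * g w0 = L w0 * g w1.
Proof.
move=> kT fx smooth xc hL fw0 fw1 ind.
pose d := w1 - w0; pose w t := w0 + t *: d.
have w_neq0 t : w t != 0.
  apply/eqP => e; have [] := ind (1 - t) t.
    by rewrite -e /w /d; apply/rowP => i; rewrite !mxE; ring.
  by move=> ? ?; lra.
have fd : dotr f d = 0 by rewrite dotrBr fw0 fw1 subr0.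
have fw t : dotr f (w t) = 0 by rewrite dotrDr dotrZr fw0 fd mulr0 addr0.
have hs t : exists s, forall u, L (w t) * (1 + s * (u - t)) <= L (w u) /\
    g (w t) * (1 + s * (u - t)) <= g (w u).
  have nd : ~~ (d <= x + w t)%MS.
    apply/sub_span2P => -[p [q e]].
    have p0 : p = 0.
      by have := congr1 (dotr f) e; rewrite fd dotrDr !dotrZr fx fw mulr0 mulr1 addr0.
    have [] := ind (- 1 - q * (1 - t)) (1 - q * t).
      have : d - q *: w t = 0 by rewrite {1}e p0 scale0r add0r subrr.
      by move=> <-; rewrite /w /d; apply/rowP => i; rewrite !mxE; ring.
    move=> e1 e2; have q0 : q = 0 by lra.
    by rewrite q0 in e2; lra.
  have [v [[p [q [r [ev r0]]]] hv]] := complemented_span3 kT nd.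
  (* Smoothness enters here: g does not drop below g x on the line x + s v, so v is tangent and lies
     in the plane of w t and d. *)
  have fv : dotr f v = 0.
    apply: smooth => s; have := hv 1 0 s; by rewrite scale1r scale0r addr0.
  have p0 : p = 0.
    by have := fv; rewrite ev !dotrDr !dotrZr fx fw fd !mulr0 !addr0 mulr1.
  (* Solving v = q (w t) + r d for d writes w u as k (w t) plus a multiple of v, with k affine in u
     of slope - q / r. Dropping the multiple of v does not increase g, nor L by [level_root_le], so
     the slope serves both. *)
  exists (- q / r) => u; set k := 1 + _.
  have -> : w u = k *: w t + ((u - t) / r) *: v.
    rewrite ev p0 /k /w /d; apply/rowP => i; rewrite !mxE; by field.
  have kL : k * L (w t) <= L (k *: w t + ((u - t) / r) *: v).
    have wu : k *: w t + ((u - t) / r) *: v != 0.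
      have -> : k *: w t + ((u - t) / r) *: v = w u.
        rewrite ev p0 /k /w /d; apply/rowP => i; rewrite !mxE; by field.
      exact: w_neq0.
    have [Lp eL] := hL _ wu; have [Lw eLw] := hL _ (w_neq0 t).
    have [k0|k0] := leP k 0; first by apply: le_trans (ltW Lp); nra.
    apply: (level_root_le xc eL).
    rewrite mulrCA -eLw -{1}(gtr0_norm k0) -(norm_scale gS gN) scalerDr scalerA addrA.
    exact: hv.
  split; first by rewrite mulrC.
  rewrite mulrC; apply: le_trans (_ : g (k *: w t) <= _).
    by rewrite (norm_scale gS gN); apply: ler_wpM2r; [apply: norm_ge0|apply: ler_norm].
  by have := hv 0 k ((u - t) / r); rewrite scale0r add0r.
have /choice[s {}hs] := hs.
have [m m0 hm] := @segment_lower_bound _ _ g w0 d gS (fun t _ => w_neq0 t).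
have sK t : 0 <= t <= 1 -> `|s t| <= g d / m.
  move=> /hm mt; have gt : 0 < g (w t) by apply: norm_gt0.
  have wS r : w (t + r) = w t + r *: d by rewrite /w scalerDl addrA.
  have [_] := hs t (t + 1); have [_] := hs t (t + (- 1)).
  rewrite !wS scale1r scaleN1r.
  have := norm_triangle gS (w t) d; have := norm_triangle gS (w t) (- d).
  rewrite gN ler_norml ler_pdivlMr // -mulNr ler_pdivrMr // => ? ? ? ?.
  by rewrite -/(w t) in mt; apply/andP; split; nra.
have := @proportional_subgradients R (L \o w) (g \o w) s (g d / m).
have w0E : w 0 = w0 by rewrite /w scale0r addr0.
have w1E : w 1 = w1 by rewrite /w scale1r /d addrC subrK.
rewrite /= w0E w1E; apply.
- by move=> t t01; split; [case: (hL _ (w_neq0 t))|apply: norm_gt0|apply: sK].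
- by move=> t u _ _; case: (hs t u).
- by move=> t u _ _; case: (hs t u).
Qed.

(* The path from w to -w passes through a third vector of the tangent hyperplane to avoid
   0; this is where n > 2 is needed. *)
Lemma smooth_point_reflection x f w : (2 < n)%N -> complemented g setT -> dotr f x = 1 ->
  (forall z, g x * dotr f z <= g z) ->
  (forall v, (forall s, g x <= g (x + s *: v)) -> dotr f v = 0) ->
  dotr f w = 0 -> g (x + w) = g (x - w).
Proof.
move=> n2 kT fx fg smooth fw.
have [->|w0] := eqVneq w 0; first by rewrite subr0 addr0.
suff h z : z != 0 -> dotr f z = 0 -> g x < g (x + z) -> g (x - z) = g (x + z).
  have [gt|le] := ltP (g x) (g (x + w)); first by rewrite h.
  have [gt|le'] := ltP (g x) (g (x - w)).
    by have := h (- w); rewrite opprK oppr_eq0 dotrNr fw oppr0 => ->.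
  apply: (@eq_trans _ _ (g x)).
    apply/eqP; rewrite eq_le le; have := fg (x + w).
    by rewrite dotrDr fx fw addr0 mulr1.
  apply/eqP; rewrite eq_le le' andbT; have := fg (x - w).
  by rewrite dotrBr fx fw subr0 mulr1.
(* The level is c = g (x + z), whence L z = 1; then L (- z) = L z, obtained by way of w1, says that
   x - z lies on the same level. *)
move=> z0 fz gt; have [L hL] := exists_level_root gt.
have [w1 [w10 fw1 zw1]] := exists_orthogonal2 f z n2.
have ind p q : p *: z + q *: w1 = 0 -> p = 0 /\ q = 0.
  move=> e; have := congr1 (dotr z) e; have := congr1 (dotr w1) e.
  rewrite !dotrDr !dotrZr (dotrC w1 z) zw1 !mulr0 addr0 add0r !dotr0.
  move=> /eqP + /eqP; rewrite !mulf_eq0 !dotrxx_eq0 (negbTE z0) (negbTE w10) !orbF.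
  by move=> /eqP -> /eqP ->.
have ind' p q : p *: (- z) + q *: w1 = 0 -> p = 0 /\ q = 0.
  by rewrite scalerN -scaleNr => /ind[/eqP + ->]; rewrite oppr_eq0 => /eqP ->.
have := level_ratio kT fx smooth gt hL fz fw1 ind.
have fNz : dotr f (- z) = 0 by rewrite dotrNr fz oppr0.
have := level_ratio kT fx smooth gt hL fNz fw1 ind'.
rewrite gN => e1; rewrite e1 => /(mulIf _) eL.
have {}eL : L (- z) = L z by apply: eL; rewrite gt_eqF //; apply: norm_gt0.
have Nz0 : - z != 0 by rewrite oppr_eq0.
have [Lz eLz] := hL _ z0; have [_ eLNz] := hL _ Nz0.
have L1 : L z = 1.
  apply/eqP; rewrite eq_le; apply/andP; split.
    apply: (level_root_le gt (r := 1) (z := z)); rewrite ?mulr1 ?scale1r //.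
    by rewrite eLz.
  apply: (level_root_le gt (r := L z) (z := z)) => //.
  by rewrite mulr1 scale1r.
by move: eLNz; rewrite eL L1 scale1r mulr1.
Qed.

End Level.

Section Reflections.
Variables (R : realType) (n : nat) (g : 'rV[R]_n -> R).
Hypotheses (gS : sublinear g) (gN : forall x, g (- x) = g x).
Implicit Types (x y z v w a b d f p : 'rV[R]_n).

(** Differentiability without derivatives: f is a support functional at x, and every line along
    which g is minimal at x is tangent to the hyperplane of f. *)
Definition smooth_at x f : Prop :=
  [/\ dotr f x = 1, forall z, g x * dotr f z <= g z &
      forall v, (forall s, g x <= g (x + s *: v)) -> dotr f v = 0].

(* p is the point of { g >= 1 } nearest to a point y slightly inside x: the Euclidean
   ball around y through p lies in the unit ball, which is therefore smooth at p. *)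
Lemma smooth_point_near x e : g x = 1 -> 0 < e ->
  exists p f, [/\ g (x - p) <= e, 1 <= g p & smooth_at p f].
Proof.
move=> gx e0.
have [_ _ _ [C gC]] := gS.
pose D := dotr x x; have D0 : 0 <= D by exact: dotrxx_ge0.
(* The estimate is g (x - p) <= g (x - y) + g (p - y) <= r + |C| r (D + 1): p is at least as close
   to y as x is, and the square root of D is at most D + 1. *)
pose K := 1 + `|C| * (D + 1).
have K1 : 1 <= K.
  by rewrite /K lerDl; apply: mulr_ge0 => //; lra.
pose r := Num.min 1 (e / K).
have r0 : 0 < r by rewrite lt_min ltr01 divr_gt0 //; lra.
have r1 : r <= 1 by rewrite ge_min lexx.
have rK : r * K <= e by rewrite -ler_pdivlMr ?ge_min ?lexx ?orbT //; lra.
pose y := (1 - r) *: x.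
have xy : x - y = r *: x by apply/rowP => i; rewrite !mxE; ring.
have gy : g y < 1 by rewrite (norm_scale gS gN) gx mulr1 ger0_norm; lra.
have cl : closed [set z | 1 <= g z].
  have h (u v : 'rV[R]_n) : - g u - - g v <= C * `|u - v|.
    rewrite opprK addrC; apply: le_trans (norm_dist gS _ _) _.
    by rewrite distrC.
  rewrite (_ : [set z | _] = [set z | - g z <= - 1]).
    exact: (lipschitz_closed_le h).
  by apply/seteqP; split => z /=; rewrite lerN2.
have [|p /= gp pmin] := nearest_point y cl; first by exists x; rewrite /= gx.
pose a := p - y.
have a0 : a != 0.
  by rewrite subr_eq0; apply/eqP => py; move: gp; rewrite py; lra.
(* Since p is nearest to y in { g >= 1 }, directions in which g stays above g p make no obtuse angle
   with a. Applied to p - z this makes a a support at p; applied to v and - v it gives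
   smoothness. *)
have out v : (forall s, 0 < s -> g p <= g (p + s *: v)) -> 0 <= dotr a v.
  move=> h; apply: dotr_ge0_of_expanding => s s0 _; have h1 := h s s0.
  rewrite /a addrAC; apply: pmin => /=; exact: le_trans h1.
have supp z : g z <= g p -> dotr a z <= dotr a p.
  move=> gz; rewrite -subr_ge0 -dotrBr; apply: out => s s0.
  have := norm_triangle gS (p + s *: (p - z)) (s *: z).
  have -> : p + s *: (p - z) + s *: z = (1 + s) *: p.
    by apply/rowP => i; rewrite !mxE; ring.
  rewrite !(norm_scale gS gN) !gtr0_norm //; last by lra.
  nra.
have gp0 : 0 < g p by lra.
have ga0 : 0 < g a by exact: norm_gt0.
have ap : 0 < dotr a p.
  have := supp ((g p / g a) *: a); rewrite (norm_scale gS gN) gtr0_norm ?divr_gt0 //.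
  rewrite divfK ?gt_eqF // dotrZr => /(_ (lexx _)); apply: lt_le_trans.
  by apply: mulr_gt0; [apply: divr_gt0|apply: dotrxx_gt0].
exists p, ((dotr a p)^-1 *: a); split => //.
  have -> : x - p = (x - y) + - a by apply/rowP => i; rewrite !mxE; ring.
  apply: le_trans (norm_triangle gS _ _) _.
  rewrite xy (norm_scale gS gN) gx mulr1 gtr0_norm // gN.
  have : `|a| ^+ 2 <= r ^+ 2 * D.
    apply: le_trans (dotrxx_ge_norm _) _; have := pmin x.
    by rewrite /= gx => /(_ (lexx _)); rewrite xy dotrZl dotrZr mulrA -expr2.
  move=> a2; have na : `|a| <= r * (D + 1).
    rewrite -ler_sqr ?nnegrE //; last by apply: mulr_ge0; lra.
    rewrite exprMn; apply: le_trans a2 _; apply: ler_wpM2l; first exact: sqr_ge0.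
    nra.
  have : g a <= `|C| * (r * (D + 1)).
    apply: le_trans (gC _) _; apply: le_trans (_ : `|C| * `|a| <= _).
      by apply: ler_wpM2r => //; apply: ler_norm.
    exact: ler_wpM2l.
  move: rK; rewrite /K; nra.
split.
- by rewrite dotrZl mulVf // gt_eqF.
- move=> z; rewrite dotrZl mulrCA ler_pdivrMl //.
  have [->|z0] := eqVneq z 0.
    by rewrite dotr0 mulr0; apply: mulr_ge0; [apply: ltW|apply: norm_ge0].
  have gz0 : 0 < g z by exact: norm_gt0.
  have := supp ((g p / g z) *: z); rewrite (norm_scale gS gN) gtr0_norm ?divr_gt0 //.
  rewrite divfK ?gt_eqF // dotrZr => /(_ (lexx _)).
  by rewrite mulrAC ler_pdivrMr.
move=> v hv; rewrite dotrZl.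
suff -> : dotr a v = 0 by rewrite mulr0.
apply/eqP; rewrite eq_le -oppr_ge0 -dotrNr !out // => s _ //.
by rewrite scalerN -scaleNr.
Qed.

(** The isometric reflection along x in the kernel of f; f.x = 1 makes it an involution. *)
Definition reflects x f : Prop :=
  dotr f x = 1 /\ forall z, g (z - (2 * dotr f z) *: x) = g z.

(** For t = f.z nonzero, z = t (x + w) with w tangent, and its image is - t (x - w), so
    [smooth_point_reflection] applies. *)
Lemma smooth_reflects x f : (2 < n)%N -> complemented g setT -> smooth_at x f ->
  reflects x f.
Proof.
move=> n2 kT [fx fg sm]; split=> // z; set t := dotr f z.
have [t0|t0] := eqVneq t 0; first by rewrite t0 mulr0 scale0r subr0.
pose w := t^-1 *: z - x.
have fw : dotr f w = 0 by rewrite dotrBr dotrZr fx mulVf // subrr.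
have e := smooth_point_reflection gS gN n2 kT fx fg sm fw.
have -> : z - (2 * t) *: x = (- t) *: (x - w).
  by apply/rowP => i; rewrite !mxE; field.
have -> : g z = g (t *: (x + w)).
  by congr g; apply/rowP => i; rewrite !mxE; field.
by rewrite !(norm_scale gS gN) normrN e.
Qed.

Lemma exists_reflection x : (2 < n)%N -> complemented g setT -> x != 0 ->
  exists f, reflects x f.
Proof.
move=> n2 kT; wlog gx : x / g x = 1 => [W x0|_].
  have gx := norm_gt0 gS x0.
  have [||f [fx hf]] := W ((g x)^-1 *: x).
  - by rewrite (norm_scale gS gN) gtr0_norm ?invr_gt0 // mulVf // gt_eqF.
  - by rewrite scaler_eq0 invr_eq0 (gt_eqF gx).
  exists ((g x)^-1 *: f); split; first by rewrite dotrZl -dotrZr.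
  by move=> z; rewrite -[RHS]hf dotrZl scalerA; congr (g (_ - _ *: x)); ring.
have [_ _ _ [C gC]] := gS.
have /choice[u hu] (k : nat) : exists pf : 'rV[R]_n * 'rV[R]_n,
    [/\ g (x - pf.1) <= k.+1%:R^-1, 1 <= g pf.1 & smooth_at pf.1 pf.2].
  have [|p [f h]] := @smooth_point_near x k.+1%:R^-1 gx; first by rewrite invr_gt0.
  by exists (p, f).
(* The bound g p >= 1 from [smooth_point_near] turns the support inequality into one uniform in
   k. *)
have ub k z : `|dotr (u k).2 z| <= g z.
  have [_ g1 [_ h _]] := hu k.
  have le v : dotr (u k).2 v <= g v.
    have [d0|/ltW d0] := leP (dotr (u k).2 v) 0; first by apply: le_trans d0 (norm_ge0 gS gN _).
    by apply: le_trans (h v); rewrite ler_peMl.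
  by rewrite ler_norml le lerNl -dotrNr -(gN z) le.
(* Testing a functional f on itself: |f|^2 <= f.f <= g f <= C |f|. *)
have nb k : `|(u k).2| <= `|C|.
  have := le_trans (ler_norm _) (ub k (u k).2); have := gC (u k).2.
  have := dotrxx_ge_norm (u k).2; have := ler_norm C; rewrite expr2.
  move: (normr_ge0 C) (normr_ge0 (u k).2).
  move: `|C| `|(u k).2| (dotr _ _) (g _) => c v d e c0 v0 Cc vd eC de.
  rewrite leNgt; apply/negP => lt.
  have : 0 < v * (v - c) by apply: mulr_gt0; lra.
  have : 0 <= v * (c - C) by apply: mulr_ge0; lra.
  lra.
pose A := [set v : 'rV[R]_n | `|v| <= `|C|].
have cA : compact A.
  apply: (@norm_bounded_compact _ _ _ `|C|) => //.
  apply: (@lipschitz_closed_le _ _ _ 1) => v w; rewrite mul1r.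
  exact: lerB_dist.
have [f Af hf] := @compact_cluster_seq _ A (fun k => (u k).2) cA nb.
have small e (D : R) : 0 < e -> 0 <= D ->
    exists N, forall k, (N <= k)%N -> D * g (x - (u k).1) <= e.
  move=> e0 D0; exists (Num.truncn (D / e)) => k hk; have [uk _ _] := hu k.
  apply: (@le_trans _ _ (D * k.+1%:R^-1)); first exact: ler_wpM2l.
  rewrite ler_pdivrMr // mulrC -ler_pdivrMr //.
  by apply: ltW; apply: lt_le_trans (truncnS_gt _) _; rewrite ler_nat ltnS.
have fx : dotr f x = 1.
  have key k : `|dotr (u k).2 x - 1| <= g (x - (u k).1).
    by have [_ _ [e1 _ _]] := hu k; rewrite -e1 -dotrBr ub.
  apply/eqP; rewrite eq_le; apply/andP; split.
    apply/ler_addgt0Pl => e e0; apply: (hf [set v | dotr v x <= e + 1]).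
      exact: dotr_closed_le.
    have [N hN] := small e 1 e0 ler01; exists N => k /hN; rewrite mul1r => le /=.
    have := le_trans (key k) le; rewrite ler_norml => /andP[]; lra.
  rewrite -lerN2 -dotrNr; apply/ler_addgt0Pl => e e0.
  apply: (hf [set v | dotr v (- x) <= e - 1]); first exact: dotr_closed_le.
  have [N hN] := small e 1 e0 ler01; exists N => k /hN; rewrite mul1r => le /=.
  have := le_trans (key k) le; rewrite ler_norml dotrNr => /andP[]; lra.
(* One inequality is enough: applied to the image of z under the involution, it gives the other. *)
have hle z : g (z - (2 * dotr f z) *: x) <= g z.
  apply/ler_addgt0Pl => e e0.
  apply: (hf [set v | g (z - (2 * dotr v z) *: x) <= e + g z]).
    have h (v w : 'rV[R]_n) : g (z - (2 * dotr v z) *: x) - g (z - (2 * dotr w z) *: x) <=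
        2 * (\sum_i `|z ord0 i|) * `|v - w|.
      apply: le_trans (norm_dist gS _ _) _.
      have -> : z - (2 * dotr v z) *: x - (z - (2 * dotr w z) *: x) =
        (2 * dotr (w - v) z) *: x by rewrite dotrBl; apply/rowP => i; rewrite !mxE; ring.
      rewrite (norm_scale gS gN) gx mulr1 normrM ger0_norm // -mulrA ler_pM2l //.
      by rewrite dotrC distrC; apply: dotr_le_norm.
    exact: (lipschitz_closed_le h).
  have D0 : 0 <= 2 * g z by apply: mulr_ge0 => //; apply: norm_ge0.
  have [N hN] := small e _ e0 D0; exists N => k /hN le /=.
  have [_ _ sm] := hu k; have [_ refl] := smooth_reflects n2 kT sm.
  have -> : z - (2 * dotr (u k).2 z) *: x = (2 * dotr (u k).2 z) *: ((u k).1 - x) +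
      (z - (2 * dotr (u k).2 z) *: (u k).1) by apply/rowP => i; rewrite !mxE; ring.
  apply: le_trans (norm_triangle gS _ _) _; rewrite refl lerD2r; apply: le_trans le.
  rewrite (norm_scale gS gN) normrM ger0_norm // -gN opprB.
  by apply: ler_wpM2r; [apply: norm_ge0|rewrite ler_pM2l].
exists f; split=> // z; apply/eqP; rewrite eq_le hle /=.
have := hle (z - (2 * dotr f z) *: x); apply: le_trans.
rewrite dotrBr dotrZr fx mulr1 le_eqVlt; apply/orP; left; apply/eqP; congr g.
by apply/rowP => i; rewrite !mxE; ring.
Qed.

End Reflections.

(** * A norm with all reflections is Euclidean *)

Section Euclidean.
Variables (R : realType) (n : nat) (g : 'rV[R]_n -> R).
Hypotheses (gS : sublinear g) (gN : forall x, g (- x) = g x).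
Hypothesis hR : forall x, x != 0 -> exists f, reflects g x f.
Implicit Types (x y z v w a b d f m k : 'rV[R]_n) (s t : R).

(* The product of two reflections in the direction x is a shear; its powers are bounded. *)
Lemma reflects_unique x f f' : x != 0 -> reflects g x f -> reflects g x f' -> f = f'.
Proof.
move=> x0 [fx hf] [f'x hf']; pose e := f' - f.
have ex : dotr e x = 0 by rewrite dotrBl fx f'x subrr.
have N z : g (z + (2 * dotr e z) *: x) = g z.
  rewrite -[RHS]hf' -[RHS]hf; congr g; rewrite dotrBl !dotrBr !dotrZr fx.
  by apply/rowP => i; rewrite !mxE; ring.
have Nk z j : g (z + (j%:R * (2 * dotr e z)) *: x) = g z.
  elim: j => [|j IH]; first by rewrite mul0r scale0r addr0.
  rewrite -[RHS]IH -[RHS]N; congr g; rewrite dotrDr dotrZr ex mulr0 addr0 -natr1.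
  by apply/rowP => i; rewrite !mxE; ring.
have gx : 0 < g x by exact: norm_gt0.
suff : dotr e e = 0 by move/eqP; rewrite dotrxx_eq0 subr_eq0 => /eqP.
apply/eqP; apply/negP => /negP ee.
have ee0 : 0 < dotr e e by rewrite lt_def ee dotrxx_ge0.
(* The j-th power of the shear displaces e by a vector of gauge 2 j (e.e) g x > 2 g e, yet preserves
   its gauge g e. *)
pose j := (Num.truncn (g e / (dotr e e * g x))).+1.
have hj : g e / (dotr e e * g x) < j%:R by apply: truncnS_gt.
rewrite ltr_pdivrMr ?mulr_gt0 // in hj.
have := norm_dist gS ((j%:R * (2 * dotr e e)) *: x) (- e).
rewrite opprK addrC gN [in X in _ <= X]addrC Nk.
rewrite (norm_scale gS gN) ger0_norm; last by rewrite !mulr_ge0 // ltW.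
lra.
Qed.

(** Vectors of gauge above 1 satisfy this vacuously, so g z = 1 is always carried along
    separately. *)
Definition extreme z := forall d, g (z + d) <= 1 -> g (z - d) <= 1 -> d = 0.

Lemma norm_convex_le1 u v t : g u <= 1 -> g v <= 1 -> 0 <= t <= 1 ->
  g (t *: u + (1 - t) *: v) <= 1.
Proof.
move=> gu gv /andP[t0 t1]; apply: le_trans (norm_triangle gS _ _) _.
rewrite !(norm_scale gS gN) !ger0_norm ?subr_ge0 //; nra.
Qed.

(** Otherwise z lies inside the segment from m to z + t (z - m), which is in the ball; the
    displacement s (z - m) with s = min t 1 stays in it on both sides of z. *)
Lemma extreme_end z m t : extreme z -> g m <= 1 -> m != z -> 0 < t ->
  1 < g (z + t *: (z - m)).
Proof.
move=> ez gm mz t0; rewrite ltNge; apply/negP => le.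
have gz : g z <= 1.
  have t1 : 0 <= (1 + t)^-1 <= 1.
    by apply/andP; split; [rewrite invr_ge0|rewrite invf_le1]; lra.
  have := norm_convex_le1 le gm t1; congr (g _ <= 1).
  by apply/rowP => i; rewrite !mxE; field; rewrite gt_eqF //; lra.
pose s := Num.min t 1.
have s0 : 0 < s by rewrite lt_min t0 ltr01.
have s1 : s <= 1 by rewrite ge_min lexx orbT.
have st : s / t <= 1 by rewrite ler_pdivrMr // mul1r ge_min lexx.
have st0 : 0 <= s / t by apply: divr_ge0; apply: ltW.
have /eqP : s *: (z - m) = 0.
  apply: ez.
    have := @norm_convex_le1 _ _ (s / t) le gz; rewrite st st0 => /(_ isT).
    by congr (g _ <= 1); apply/rowP => i; rewrite !mxE; field; rewrite gt_eqF.
  have := @norm_convex_le1 _ _ s gm gz; rewrite s1 ltW // => /(_ isT).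
  by congr (g _ <= 1); apply/rowP => i; rewrite !mxE; ring.
by rewrite scaler_eq0 subr_eq0 (gt_eqF s0) /= eq_sym (negbTE mz).
Qed.

(* The hypotheses say that the line through z and m meets the unit ball exactly in the
   segment [z, m]; the reflection along it must exchange the ends. *)
Lemma reflection_swaps z m f : g z = 1 -> g m = 1 ->
  (forall t, 0 < t -> 1 < g (m + t *: (m - z))) ->
  (forall t, 0 < t -> 1 < g (z + t *: (z - m))) ->
  reflects g (m - z) f -> dotr f z = - 2^-1 /\ dotr f m = 2^-1.
Proof.
move=> gz gm hm hz [fd hf]; have fm : dotr f m = 1 + dotr f z by rewrite -fd dotrBr subrK.
pose s := - (2 * dotr f z).
have rz : g (z + s *: (m - z)) = 1 by rewrite /s scaleNr hf.
have rm : g (z + (s - 1) *: (m - z)) = 1.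
  rewrite -[RHS]gm -[RHS]hf; congr g; rewrite fm /s.
  by apply/rowP => i; rewrite !mxE; ring.
have in01 r : g (z + r *: (m - z)) = 1 -> 0 <= r <= 1.
  move=> e; apply/andP; split; rewrite leNgt; apply/negP => lt.
    have := hz (- r); rewrite oppr_gt0 => /(_ lt).
    by rewrite scaleNr -scalerN opprB e ltxx.
  have := hm (r - 1); rewrite subr_gt0 => /(_ lt).
  have -> : m + (r - 1) *: (m - z) = z + r *: (m - z).
    by apply/rowP => i; rewrite !mxE; ring.
  by rewrite e ltxx.
have /andP[_ s1] := in01 _ rz; have /andP[s0 _] := in01 _ rm.
rewrite fm; move: s0 s1; rewrite /s => ? ?; split; lra.
Qed.

(** A point k of the ball with maximal Euclidean norm is extreme by the parallelogram identity.
    Extremality gives g k = 1: k lies midway between k / g k and (2 - 1 / g k) k, of gauges 1 and |2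
    g k - 1|. *)
Lemma exists_extreme : (0 < n)%N -> exists k, extreme k /\ g k = 1.
Proof.
move=> n0; pose B := [set x | g x <= 1].
have [_ _ [c c0 gc] [C gC]] := gS.
have cB : compact B.
  apply: (@norm_bounded_compact _ _ _ c^-1) => [x gx|].
    by rewrite -[c^-1]mul1r ler_pdivlMr // mulrC; apply: le_trans (gc x) gx.
  have h (u v : 'rV[R]_n) : g u - g v <= C * `|u - v|.
    exact: le_trans (norm_dist gS _ _) _.
  exact: (lipschitz_closed_le h).
have [|k] := EVT_max_rV _ cB (continuous_subspaceT (@dotrxx_continuous R n)).
  by exists 0; rewrite /B /= (norm_0 gS gN).
rewrite inE => gk kmax; rewrite /B /= in gk.
have ek : extreme k.
  move=> d h1 h2; have := kmax (k + d); have := kmax (k - d); rewrite !inE => /(_ h2) + /(_ h1).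
  rewrite dotrBr !dotrBl dotrDr !dotrDl (dotrC d k) => le1 le2.
  apply/eqP; rewrite -dotrxx_eq0 eq_le dotrxx_ge0 andbT; lra.
exists k; split => //.
have k0 : k != 0.
  apply/eqP => k0; pose e : 'rV[R]_n := delta_mx 0 (Ordinal n0).
  have e0 : e != 0 by apply/eqP => /rowP/(_ (Ordinal n0))/eqP; rewrite !mxE !eqxx oner_eq0.
  have ge := norm_gt0 gS e0.
  have := kmax ((g e)^-1 *: e); rewrite inE /B /= (norm_scale gS gN) gtr0_norm ?invr_gt0 //.
  rewrite mulVf ?gt_eqF // => /(_ (lexx _)).
  rewrite k0 dotr0 leNgt dotrxx_gt0 // scaler_eq0 invr_eq0 (gt_eqF ge) //.
have g0 := norm_gt0 gS k0.
have /eqP : ((g k)^-1 - 1) *: k = 0.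
  have i0 : 1 <= (g k)^-1 by rewrite invf_ge1.
  apply: ek.
    have -> : k + ((g k)^-1 - 1) *: k = (g k)^-1 *: k by apply/rowP => i; rewrite !mxE; ring.
    by rewrite (norm_scale gS gN) gtr0_norm ?invr_gt0 // mulVf // gt_eqF.
  have -> : k - ((g k)^-1 - 1) *: k = (2 - (g k)^-1) *: k by apply/rowP => i; rewrite !mxE; ring.
  rewrite (norm_scale gS gN).
  have -> : `|2 - (g k)^-1| * g k = `|2 * g k - 1|.
    by rewrite -{2}(gtr0_norm g0) -normrM mulrBl mulVf // gt_eqF.
  by rewrite ler_norml; apply/andP; split; lra.
rewrite scaler_eq0 (negbTE k0) orbF subr_eq0 => /eqP e.
by rewrite -[g k]invrK e invr1.
Qed.

(* For an extreme point k, one of the segments [k, m] and [-k, m] is a full chord, and a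
   reflection then maps the extreme point at its other end to m. *)
Lemma unit_extreme m : (0 < n)%N -> g m = 1 -> extreme m.
Proof.
move=> n0 gm; have [k0 [ek0 gk0]] := exists_extreme n0.
suff [k [ek gk hm]] : exists k, [/\ extreme k, g k = 1 &
    forall t, 0 < t -> m != k -> 1 < g (m + t *: (m - k))].
  have [->//|mk] := eqVneq m k.
  have [|f hf] := hR (x := m - k); first by rewrite subr_eq0.
  have mE : g m <= 1 by rewrite gm.
  have [fk fm] := reflection_swaps gk gm (fun t ht => hm t ht mk)
    (fun t ht => extreme_end ek mE mk ht) hf.
  have [fd rf] := hf.
  pose U z := z - (2 * dotr f z) *: (m - k).
  have UU z : U (U z) = z.
    rewrite /U dotrBr dotrZr fd; apply/rowP => i; rewrite !mxE; ring.
  have Um d : U (m + d) = k + U d.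
    rewrite /U dotrDr fm; apply/rowP => i; rewrite !mxE; by field.
  move=> d h1 h2; rewrite -(UU d); suff -> : U d = 0.
    by rewrite /U dotr0 mulr0 scale0r subr0.
  apply: ek; first by rewrite -Um /U rf.
  have -> : k - U d = U (m - d).
    by rewrite Um /U dotrNr; apply/rowP => i; rewrite !mxE; ring.
  by rewrite /U rf.
have [h|] := pselect (forall t, 0 < t -> 1 < g (m + t *: (m - k0))).
  by exists k0; split => // t t0 _; apply: h.
move=> /existsNP[t /not_implyP[t0 /negP]]; rewrite -leNgt => ht.
(* If the chords from k0 and from - k0 could both be prolonged beyond m, by t and r, averaging with
   weights r and t would cancel k0 and leave a multiple of m by a factor above 1 in the ball. *)
exists (- k0); split; last first.
- move=> r r0 _; rewrite ltNge opprK; apply/negP => hr.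
  have tr : 0 < t + r by lra.
  have w : 0 <= r / (t + r) <= 1.
    by rewrite ler_pdivrMr // mul1r divr_ge0 ?ltW //=; lra.
  have := norm_convex_le1 ht hr w.
  have -> : (r / (t + r)) *: (m + t *: (m - k0)) + (1 - r / (t + r)) *: (m + r *: (m + k0)) =
      (1 + 2 * r * t / (t + r)) *: m.
    by apply/rowP => i; rewrite !mxE; field; rewrite gt_eqF.
  have pos : 0 < 2 * r * t / (t + r) by apply: divr_gt0 => //; nra.
  rewrite (norm_scale gS gN) gm mulr1 gtr0_norm; lra.
- by rewrite gN.
- move=> d h1 h2; apply: ek0; first by rewrite -gN opprD.
  by rewrite -gN opprB addrC.
Qed.

(** The reflection U along x - y exchanges the extreme points x and y. Conjugated by U, the
    reflection at x becomes one at y, with functional fx o U; by uniqueness this is fy, and fy.x =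
    fx.(U x) = fx.y. *)
Lemma reflection_functional_sym x y fx fy : (0 < n)%N -> g x = 1 -> g y = 1 ->
  reflects g x fx -> reflects g y fy -> dotr fx y = dotr fy x.
Proof.
move=> n0 gx gy hx hy.
have y0 : y != 0.
  apply/eqP => y0; move: gy; rewrite y0 (norm_0 gS gN).
  by move/eqP; rewrite eq_sym oner_eq0.
have [e|xy] := eqVneq x y; first by rewrite e in hx *; rewrite (reflects_unique y0 hx hy).
have [|f hf] := hR (x := x - y); first by rewrite subr_eq0.
have ex := unit_extreme n0 gx; have ey := unit_extreme n0 gy.
have gx1 : g x <= 1 by rewrite gx.
have gy1 : g y <= 1 by rewrite gy.
have yx : y != x by rewrite eq_sym.
have [fy1 fx1] := reflection_swaps gy gx (fun t ht => extreme_end ex gy1 yx ht)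
  (fun t ht => extreme_end ey gx1 xy ht) hf.
have [fd rf] := hf; have [fxx rx] := hx.
pose U z := z - (2 * dotr f z) *: (x - y).
have Ux : U x = y by rewrite /U fx1; apply/rowP => i; rewrite !mxE; field.
have Uy : U y = x by rewrite /U fy1; apply/rowP => i; rewrite !mxE; field.
pose f' := fx - (2 * dotr fx (x - y)) *: f.
have f'E z : dotr f' z = dotr fx (U z).
  by rewrite /f' /U dotrBl dotrZl [RHS]dotrBr dotrZr; ring.
have hf' : reflects g y f'.
  split; first by rewrite f'E Uy.
  move=> z; rewrite -(rf z) -/(U z) -(rx (U z)) -f'E -[LHS]rf; congr g.
  rewrite dotrBr dotrZr fy1 /U; apply/rowP => i; rewrite !mxE.
  by field.
by rewrite (reflects_unique y0 hy hf') f'E Ux.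
Qed.

(** The factor g x ^ 2 makes G homogeneous of degree one, as F has degree - 1, and gives G x.x = g x
    ^ 2. By [sym] the pairing is bilinear, so it is determined by Q, whose rows are the G e_i. *)
Lemma euclidean_form : (0 < n)%N ->
  exists Q : 'M[R]_n, Q^T = Q /\ forall x, dotr (x *m Q) x = g x ^+ 2.
Proof.
move=> n0.
have /choice[F hF] x : exists f, x != 0 -> reflects g x f.
  by have [->|/hR[f hf]] := eqVneq x 0; [exists 0|exists f].
pose G x := if x == 0 then 0 else (g x ^+ 2) *: F x.
have dot0 z : dotr (0 : 'rV[R]_n) z = 0 by rewrite dotrC dotr0.
have sym x y : dotr (G x) y = dotr (G y) x.
  rewrite /G; have [->|x0] := eqVneq x 0; first by rewrite dot0 dotr0.
  have [->|y0] := eqVneq y 0; first by rewrite dot0 dotr0.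
  have gx := norm_gt0 gS x0; have gy := norm_gt0 gS y0.
  have unit z : z != 0 -> g ((g z)^-1 *: z) = 1.
    move=> z0; have gz := norm_gt0 gS z0.
    by rewrite (norm_scale gS gN) gtr0_norm ?invr_gt0 // mulVf // gt_eqF.
  have refl z : z != 0 -> reflects g ((g z)^-1 *: z) (g z *: F z).
    move=> z0; have gz := norm_gt0 gS z0; have [Fz rz] := hF z z0; split.
      by rewrite dotrZl dotrZr Fz mulr1 divff // gt_eqF.
    move=> u; rewrite -[RHS]rz dotrZl scalerA; congr (g (_ - _ *: _)).
    by field; rewrite gt_eqF.
  have := reflection_functional_sym n0 (unit x x0) (unit y y0) (refl x x0) (refl y y0).
  rewrite !dotrZl !dotrZr => e.
  have -> : g x ^+ 2 * dotr (F x) y = g x * g y * (g x * ((g y)^-1 * dotr (F x) y)).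
    by field; rewrite gt_eqF.
  by rewrite e; field; rewrite gt_eqF.
have diag x : dotr (G x) x = g x ^+ 2.
  rewrite /G; have [->|x0] := eqVneq x 0.
    by rewrite dot0 (norm_0 gS gN) expr0n.
  by have [Fx _] := hF x x0; rewrite dotrZl Fx mulr1.
pose Q := \matrix_(i < n, j < n) G (delta_mx 0 i) 0 j.
have Qij i j : Q i j = dotr (G (delta_mx 0 i)) (delta_mx 0 j).
  by rewrite dotr_delta mxE.
exists Q; split; first by apply/matrixP => i j; rewrite mxE !Qij sym.
move=> x; rewrite -diag; apply: eq_bigr => j _; congr (_ * _).
rewrite -(dotr_delta (G x)) sym mxE; apply: eq_bigr => i _.
by rewrite mulrC Qij sym dotr_delta.
Qed.

End Euclidean.

(** Gram-Schmidt by dimension count: Q M^T has k < n columns, so some nonzero x is Q-orthogonal to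
    all rows of M; it is then normalised. *)
Lemma exists_orthonormal_rows (R : realType) (n k : nat) (Q : 'M[R]_n) :
  Q^T = Q -> (forall x, x != 0 -> 0 < dotr (x *m Q) x) -> (k <= n)%N ->
  exists M : 'M[R]_(k, n), M *m Q *m M^T = 1%:M.
Proof.
move=> Qs Qp; elim: k => [|k IH] kn.
  by exists 0; apply/matrixP => -[].
have [M hM] := IH (ltnW kn).
have [x x0 hx] := exists_left_kernel (Q *m M^T) kn.
have c0 := Qp x x0; set c := dotr _ _ in c0.
pose y := (Num.sqrt c)^-1 *: x.
have hy : y *m Q *m M^T = 0 by rewrite -mulmxA -scalemxAl hx scaler0.
have hy' : M *m Q *m y^T = 0.
  by apply: trmx_inj; rewrite !trmx_mul trmxK trmx0 Qs mulmxA.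
have yy : y *m Q *m y^T = 1%:M.
  rewrite /y linearZ /= -!scalemxAl -scalemxAr scalerA.
  have -> : x *m Q *m x^T = c%:M.
    apply/matrixP => i j; rewrite !mxE !ord1 eqxx mulr1n /c.
    by apply: eq_bigr => l _; rewrite !mxE.
  rewrite scale_scalar_mx -expr2 exprVn sqr_sqrtr ?ltW // mulVf ?gt_eqF //.
suff : exists M' : 'M[R]_(k + 1, n), M' *m Q *m M'^T = 1%:M by rewrite addn1.
exists (col_mx M y); rewrite mul_col_mx tr_col_mx mul_col_row hM hy hy' yy.
by rewrite scalar_mx_block.
Qed.

Lemma norm_ball_ellipsoid (R : realType) (n : nat) (g : 'rV[R]_n -> R) (Q : 'M[R]_n) :
  (forall x, 0 <= g x) -> (forall x, x != 0 -> 0 < g x) ->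
  Q^T = Q -> (forall x, dotr (x *m Q) x = g x ^+ 2) ->
  ellipsoid 0 [set x | g x <= 1].
Proof.
move=> g0 gp Qs hQ.
have [|M hM] := exists_orthonormal_rows Qs _ (leqnn n).
  by move=> x x0; rewrite hQ exprn_gt0 // gp.
have Mu : M \in unitmx by have /mulmx1_unit[] : M *m (Q *m M^T) = 1%:M by rewrite mulmxA.
have gM y : g (y *m M) = Num.sqrt (dotr y y).
  rewrite -[LHS]ger0_norm // -sqrtr_sqr -hQ; congr Num.sqrt.
  have dE (a b : 'rV[R]_n) : dotr a b = (a *m b^T) 0 0.
    by rewrite mxE; apply: eq_bigr => i _; rewrite mxE.
  by rewrite !dE trmx_mul -!mulmxA (mulmxA Q) (mulmxA M) (mulmxA M) hM mul1mx.
exists M => //; apply/seteqP; split=> x /=.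
  move=> gx; exists (x *m invmx M); last by rewrite add0r mulmxKV.
  by rewrite /euclidean_unit_ball /= -gM mulmxKV.
by move=> [y yb <-]; rewrite add0r gM.
Qed.

(** * From sections and chords to the gauge *)

(* If v is c / b for a small height b, then x - (a . x) v stays in the ball for all x in
   it above that height, by convexity; v is a cluster point of these vectors as b -> 0. *)
Lemma complemented_of_sections (R : realType) (n : nat) (g : 'rV[R]_n -> R) :
  sublinear g -> (forall x, g (- x) = g x) ->
  (forall a b, a != 0 -> (exists2 x, g x <= 1 & dotr a x = b) ->
    exists2 c, dotr a c = b & forall x, g x <= 1 -> dotr a x = b -> g (x - c) <= 1) ->
  complemented g setT.
Proof.
move=> gS gN sec a [x1 _ ax1].
have a0 : a != 0 by apply/eqP => a0; rewrite a0 dotrC dotr0 eqxx in ax1.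
have x10 : x1 != 0 by apply/eqP => x10; rewrite x10 dotr0 eqxx in ax1.
have g1 := norm_gt0 gS x10.
have [xs gxs axs] : exists2 x, g x <= 1 & 0 < dotr a x.
  exists ((Num.sg (dotr a x1) / g x1) *: x1).
    rewrite (norm_scale gS gN) normrM normr_sg ax1 mul1r ger0_norm ?invr_ge0 ?(ltW g1) //.
    by rewrite mulVf // gt_eqF.
  rewrite dotrZr mulrAC -normrEsg divr_gt0 ?normr_gt0 //.
pose eps (k : nat) := dotr a xs / k.+1%:R.
have eps0 k : 0 < eps k by apply: divr_gt0.
have /choice[c hc] (k : nat) : exists c, dotr a c = eps k /\
    forall x, g x <= 1 -> dotr a x = eps k -> g (x - c) <= 1.
  have [|c ? ?] := sec a (eps k) a0; last by exists c.
  exists (k.+1%:R^-1 *: xs); last by rewrite dotrZr mulrC.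
  rewrite (norm_scale gS gN) ger0_norm ?invr_ge0 //.
  by rewrite mulr_ile1 ?invr_ge0 ?norm_ge0 // invf_le1 ?ler1n.
pose v k := (eps k)^-1 *: c k.
have shift k x : g x <= 1 -> eps k <= dotr a x -> g (x - dotr a x *: v k) <= 1.
  move=> gx ex; have ax0 : 0 < dotr a x by apply: lt_le_trans ex.
  rewrite leNgt; apply/negP; set z := x - _ => gz.
  have [ac h] := hc k.
  have avk : dotr a (v k) = 1 by rewrite /v dotrZr ac mulVf // gt_eqF.
  have az : dotr a z = 0 by rewrite dotrBr dotrZr avk mulr1 subrr.
  (* With this t the point t x + (1 - t) y of the ball has height [eps k]; subtracting c k leaves a
     multiple of z of gauge t g z + (1 - t) > 1. *)
  pose t := eps k / dotr a x.
  have t0 : 0 < t by apply: divr_gt0.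
  have t1 : t <= 1 by rewrite ler_pdivrMr // mul1r.
  pose y := (g z)^-1 *: z.
  have gz0 : 0 < g z by lra.
  have gy : g y = 1 by rewrite (norm_scale gS gN) gtr0_norm ?invr_gt0 // mulVf // gt_eqF.
  have gy1 : g y <= 1 by rewrite gy.
  have t01 : 0 <= t <= 1 by rewrite (ltW t0).
  have := h _ (norm_convex_le1 gS gN gx gy1 t01).
  rewrite dotrDr !dotrZr az !mulr0 addr0 {1}/t divfK ?gt_eqF // => /(_ erefl).
  have -> : t *: x + (1 - t) *: y - c k = (t + (1 - t) / g z) *: z.
    have -> : c k = eps k *: v k by rewrite /v scalerA divff ?scale1r // gt_eqF.
    have -> : eps k = t * dotr a x by rewrite /t divfK // gt_eqF.
    by rewrite /y /z; apply/rowP => i; rewrite !mxE; ring.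
  rewrite (norm_scale gS gN) ger0_norm; last first.
    by apply: addr_ge0; [apply: ltW|apply: divr_ge0; lra].
  rewrite mulrDl divfK ?gt_eqF //; nra.
have vb k : g (v k) <= 2 / dotr a xs.
  have := shift k xs gxs; rewrite ler_pdivlMr //.
  have -> : eps k <= dotr a xs by rewrite /eps ler_pdivrMr // ler_peMr ?(ltW axs) // ler1n.
  move=> /(_ isT) le; rewrite mulrC -[X in X * _]gtr0_norm // -(norm_scale gS gN).
  by have := norm_dist gS (dotr a xs *: v k) xs; rewrite -(gN (_ - xs)) opprB; lra.
have [_ _ [c0 c00 gc] _] := gS.
pose M := 2 / dotr a xs / c0.
pose A := [set v : 'rV[R]_n | `|v| <= M].
have cA : compact A.
  apply: (@norm_bounded_compact _ _ _ M) => //.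
  apply: (@lipschitz_closed_le _ _ _ 1) => u w; rewrite mul1r.
  exact: lerB_dist.
have [|w Aw hw] := @compact_cluster_seq _ A v cA.
  by move=> k; rewrite /A /= ler_pdivlMr // mulrC; apply: le_trans (vb k).
have pos x : g x <= 1 -> 0 < dotr a x -> g (x - dotr a x *: w) <= 1.
  move=> gx ax; apply: (hw [set v | g (x - dotr a x *: v) <= 1]).
    exact: norm_affine_closed_le.
  exists (Num.truncn (dotr a xs / dotr a x)) => k hk; apply: shift => //.
  rewrite /eps ler_pdivrMr // mulrC -ler_pdivrMr //.
  by apply: ltW; apply: lt_le_trans (truncnS_gt _) _; rewrite ler_nat ltnS.
have le1 x : g x <= 1 -> g (x - dotr a x *: w) <= 1.
  move=> gx; case: (ltgtP (dotr a x) 0) => [ax|ax|->]; last by rewrite scale0r subr0.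
    have := pos (- x); rewrite gN dotrNr oppr_gt0 => /(_ gx ax).
    by rewrite -gN opprB scaleNr opprK addrC.
  exact: pos.
exists w; split => //.
  rewrite dotrC; apply: (hw [set v | dotr v a = 1]); first exact: dotr_closed_eq.
  by exists 0%N => k _ /=; rewrite dotrC /v dotrZr; case: (hc k) => -> _; rewrite mulVf // gt_eqF.
move=> x _; have [->|x0] := eqVneq x 0; first by rewrite dotr0 scale0r subr0.
have gx := norm_gt0 gS x0.
have := le1 ((g x)^-1 *: x); rewrite (norm_scale gS gN) gtr0_norm ?invr_gt0 //.
rewrite mulVf ?gt_eqF // => /(_ (lexx _)).
have -> : (g x)^-1 *: x - dotr a ((g x)^-1 *: x) *: w = (g x)^-1 *: (x - dotr a x *: w).
  by rewrite dotrZr; apply/rowP => i; rewrite !mxE; ring.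
by rewrite (norm_scale gS gN) gtr0_norm ?invr_gt0 // ler_pdivrMl // mulr1.
Qed.

(** * Central symmetry from parked chords *)

Section ChordsThroughOrigin.
Variables (R : realType) (n : nat) (B : set 'rV[R]_n).
Hypotheses (n2 : (2 < n)%N) (cB : compact B) (vB : convex_set B).
Hypotheses (iB : interior B !=set0) (B0 : B 0).
(** This is property (iii) for the segment from y to x: the translate that contains 0 ends at t (x -
    y) and - (1 - t) (x - y). *)
Hypothesis chord : forall x y, B x -> B y -> exists2 t : R, 0 <= t <= 1 &
  B (t *: (x - y)) /\ B (- ((1 - t) *: (x - y))).
Implicit Types (x y z u v w a : 'rV[R]_n).

Let clB : closed B.
Proof. by apply: compact_closed cB; apply: norm_hausdorff. Qed.

(* Otherwise B lies in a half-space { a <= 0 }, and the chord condition puts every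
   difference x - y of points of B with a . (x - y) < 0 into B. By a limit, B contains
   some w <> 0 with a . w = 0, and then it is invariant under subtraction of w inside
   { a < 0 }, hence unbounded. *)
Lemma origin_interior : interior B 0.
Proof.
apply: contrapT => ni.
have [|a a0 ha] := @supporting_functional _ _ B 0 clB vB (ex_intro _ 0 B0).
  move=> e e0; apply: contrapT => h; apply: ni; apply/nbhs_ballP.
  exists e => //= y; rewrite -ball_normE /= sub0r normrN => ye.
  by apply: contrapT => nBy; apply: h; exists y => //; rewrite subr0 ltW.
have {}ha x : B x -> dotr a x <= 0 by move/ha; rewrite dotr0.
have [x0 /nbhs_ballP[e /= e0 eB]] := iB.
have eB' z : `|z| < e -> B (x0 + z).
  by move=> ze; apply: eB; rewrite -ball_normE /= opprD addrA subrr sub0r normrN.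
have Bx0 : B x0 by have := eB' 0; rewrite addr0 normr0; apply.
have near u : u != 0 -> exists2 r : R, 0 < r & `|r *: u| < e.
  move=> u0; have nu : 0 < `|u| by rewrite normr_gt0.
  exists (e / 2 / `|u|); first by rewrite !divr_gt0.
  by rewrite normrZ ger0_norm ?divfK ?gt_eqF // ?divr_ge0 ?ltW // ltr_pdivrMr // ltr_pMr // ltr1n.
have ax0 : dotr a x0 < 0.
  have [r r0 /eB'/ha] := near a a0; rewrite dotrDr dotrZr.
  by have := mulr_gt0 r0 (dotrxx_gt0 a0); lra.
have [w' [w'0 aw' _]] := exists_orthogonal2 a a n2.
have [r r0 rw] := near w' w'0.
pose w := r *: w'.
have w0 : w != 0 by rewrite scaler_eq0 negb_or gt_eqF.
have aw : dotr a w = 0 by rewrite dotrZr aw' mulr0.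
have Bp : B (x0 + w) by apply: eB'.
have Bm : B (x0 - w) by apply: eB'; rewrite normrN.
clearbody w.
(* On the end - (1 - t) (x - y) of the parked segment a would be positive unless t = 1. *)
have diff x y : B x -> B y -> dotr a (x - y) < 0 -> B (x - y).
  move=> Bx By axy; have [t /andP[t0 t1] [Bt /ha]] := chord Bx By.
  rewrite dotrNr dotrZr oppr_le0 => h.
  have t_1 : t = 1.
    apply/eqP; rewrite eq_le t1 leNgt; apply/negP => tl.
    by move: h; rewrite leNgt pmulr_rlt0 ?subr_gt0 // axy.
  by move: Bt; rewrite t_1 scale1r.
(* The difference 2 w of x0 + w and x0 - w has height 0, where [diff] is silent; shrinking x0 - w by
   1 - s lowers the height to s (a.x0) < 0. *)
have Bw : B (2 *: w).
  apply: closed_approx => // d d0; pose s := Num.min 1 (d / (`|x0 - w| + 1)).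
  have N0 : 0 < `|x0 - w| + 1 by rewrite ltr_wpDl.
  have s0 : 0 < s by rewrite lt_min ltr01 divr_gt0.
  have s1 : s <= 1 by rewrite ge_min lexx.
  have sd : s * (`|x0 - w| + 1) <= d by rewrite -ler_pdivlMr // ge_min lexx orbT.
  clearbody s; exists ((x0 + w) - (1 - s) *: (x0 - w)).
    apply: diff => //; first by apply: scaled_mem => //; apply/andP; split; lra.
    rewrite !(dotrDr, dotrNr, dotrZr) aw oppr0 !addr0.
    have : 0 < s * - dotr a x0 by rewrite mulr_gt0 // oppr_gt0.
    lra.
  have -> : x0 + w - (1 - s) *: (x0 - w) - 2 *: w = s *: (x0 - w).
    by apply/rowP => i; rewrite !mxE; ring.
  by rewrite normrZ gtr0_norm //; apply: le_trans sd; apply: ler_wpM2l; lra.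
have Bk (k : nat) : B (x0 - k%:R *: (2 *: w)).
  elim: k => [|k IH]; first by rewrite scale0r subr0.
  have -> : x0 - k.+1%:R *: (2 *: w) = x0 - k%:R *: (2 *: w) - 2 *: w.
    by rewrite -natr1; apply/rowP => i; rewrite !mxE; ring.
  by apply: diff => //; rewrite !(dotrDr, dotrNr, dotrZr) aw !mulr0 oppr0 !addr0.
have [M [_ hM]] := compact_bounded cB.
have nw : 0 < `|w| by rewrite normr_gt0.
pose N := Num.truncn ((M + 1 + `|x0|) / `|w|).
have := hM (M + 1) _ _ (Bk N.+1); rewrite ltrDl ltr01 => /(_ isT).
apply/negP; rewrite -ltNge.
have hN : M + 1 + `|x0| < N.+1%:R * `|w| by rewrite -ltr_pdivrMr //; apply: truncnS_gt.
have := lerB_dist (N.+1%:R *: (2 *: w)) x0.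
rewrite -(normrN (_ - x0)) opprB !normrZ (ger0_norm (ler0n _ _)) ger0_norm //.
have : 0 <= N.+1%:R * `|w| by apply: mulr_ge0.
lra.
Qed.

Section Gauge.
Variable g : 'rV[R]_n -> R.
Hypotheses (gS : sublinear g) (Bg : forall x, B x <-> g x <= 1).

Let gZ t x : 0 <= t -> g (t *: x) = t * g x.
Proof. by case: gS => _ h _ _; apply: h. Qed.

(* The chord through the origin is the longest one in its direction, so its ends have
   parallel supporting hyperplanes. *)
Lemma parallel_supports u : u != 0 -> exists a, [/\ dotr a u = 1,
  forall z, g u * dotr a z <= g z & forall z, g (- u) * dotr a z <= g (- z)].
Proof.
move=> u0; have nu0 : - u != 0 by rewrite oppr_eq0.
have gu := norm_gt0 gS u0; have gnu := norm_gt0 gS nu0.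
pose r := (g u)^-1; pose s := (g (- u))^-1.
have r0 : 0 < r by rewrite invr_gt0.
have s0 : 0 < s by rewrite invr_gt0.
have rg : r * g u = 1 by rewrite mulVf // gt_eqF.
have sg : s * g (- u) = 1 by rewrite mulVf // gt_eqF.
(* A support a of the difference body B - B at (r + s) u is maximal over B at r u and minimal at - s
   u, hence supports B at both ends of the chord. *)
pose T := [set p.1 - p.2 | p in B `*` B].
have cT : closed T.
  apply: compact_closed; first exact: norm_hausdorff.
  apply: continuous_compact; last exact: compact_setX.
  apply: continuous_subspaceT => p.
  by apply: (@continuousB R _ _ fst snd); [exact: cvg_fst|exact: cvg_snd].
have vT : convex_set T.
  apply/convex_setP => x y t [[x1 x2] [/= Bx1 Bx2] <-] [[y1 y2] [/= By1 By2] <-] t0 t1.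
  move/convex_setP: vB => vB'.
  exists (t *: x1 + (1 - t) *: y1, t *: x2 + (1 - t) *: y2).
    by split; apply: vB'.
  by apply/rowP => i; rewrite !mxE /=; ring.
have T0 : T !=set0 by exists (0 - 0), (0, 0).
have [|a a0 ha] := @supporting_functional _ _ T ((r + s) *: u) cT vT T0.
  move=> e e0; pose z := (r + s) *: u; pose d := e / (`|z| + 1).
  have z1 : 0 < `|z| + 1 by rewrite ltr_wpDl.
  have d0 : 0 < d by apply: divr_gt0.
  exists ((1 + d) *: z); last first.
    have -> : (1 + d) *: z - (r + s) *: u = d *: z by apply/rowP => i; rewrite !mxE; ring.
    rewrite normrZ gtr0_norm //; have : d * (`|z| + 1) = e by rewrite /d divfK // gt_eqF.
    lra.
  (* A longer chord, parked, would give t (1 + d) (r + s) <= r and (1 - t) (1 + d) (r + s) <= s,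
     whose sum is absurd. *)
  move=> [[x y] [/= Bx By] exy]; have [t /andP[t0 t1]] := chord Bx By.
  have k0 : 0 < (1 + d) * (r + s) by apply: mulr_gt0; lra.
  rewrite exy /z !scalerA -scalerN !Bg !gZ; try by repeat apply: mulr_ge0; lra.
  move=> [h1 h2].
  have {}h1 : t * (1 + d) * (r + s) <= r.
    by rewrite -(ler_pM2r gu) rg; move: h1; congr (_ <= _); ring.
  have {}h2 : (1 - t) * (1 + d) * (r + s) <= s.
    by rewrite -(ler_pM2r gnu) sg; move: h2; congr (_ <= _); ring.
  nra.
have hT x y : B x -> B y -> dotr a x - dotr a y <= (r + s) * dotr a u.
  by move=> Bx By; rewrite -dotrBr -dotrZr; apply: ha; exists (x, y).
have Bru : B (r *: u) by apply/Bg; rewrite gZ ?(ltW r0) // /r mulVf // gt_eqF.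
have Bsu : B (- (s *: u)) by apply/Bg; rewrite -scalerN gZ ?(ltW s0) // /s mulVf // gt_eqF.
have hx x : B x -> dotr a x <= r * dotr a u.
  by move=> Bx; have := hT _ _ Bx Bsu; rewrite dotrNr dotrZr; lra.
have hy y : B y -> - dotr a y <= s * dotr a u.
  by move=> By; have := hT _ _ Bru By; rewrite dotrZr; lra.
have au : 0 < dotr a u.
  have ga := norm_gt0 gS a0.
  have := hx ((g a)^-1 *: a).
  rewrite Bg gZ ?invr_ge0 ?(ltW ga) // mulVf ?gt_eqF // => /(_ (lexx _)).
  rewrite dotrZr => le; rewrite -(pmulr_rgt0 _ r0); apply: lt_le_trans le.
  by apply: mulr_gt0; [rewrite invr_gt0|apply: dotrxx_gt0].
exists ((dotr a u)^-1 *: a); split; first by rewrite dotrZl mulVf // gt_eqF.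
  move=> z; rewrite dotrZl; have [->|z0] := eqVneq z 0.
    by rewrite dotr0 !mulr0 -(scale0r u) gZ // mul0r.
  have gz := norm_gt0 gS z0.
  have := hx ((g z)^-1 *: z).
  rewrite Bg gZ ?invr_ge0 ?(ltW gz) // mulVf ?gt_eqF // => /(_ (lexx _)).
  rewrite dotrZr ler_pdivrMl // => /(ler_wpM2l (ltW gu)).
  have -> : g u * (g z * (r * dotr a u)) = (r * g u) * (dotr a u * g z) by ring.
  by rewrite rg mul1r mulrCA ler_pdivrMl.
move=> z; rewrite dotrZl; have [->|z0] := eqVneq z 0.
  by rewrite dotr0 !mulr0 oppr0 -(scale0r u) gZ // mul0r.
have gz : 0 < g (- z) by apply: norm_gt0; rewrite ?oppr_eq0.
have := hy ((g (- z))^-1 *: (- z)).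
rewrite Bg gZ ?invr_ge0 ?(ltW gz) // mulVf ?gt_eqF // => /(_ (lexx _)).
rewrite dotrZr dotrNr mulrN opprK ler_pdivrMl // => /(ler_wpM2l (ltW gnu)).
have -> : g (- u) * (g (- z) * (s * dotr a u)) = (s * g (- u)) * (dotr a u * g (- z)) by ring.
by rewrite sg mul1r mulrCA ler_pdivrMl.
Qed.

Lemma antipodal_ratio w0 w1 : (forall p q : R, p *: w0 + q *: w1 = 0 -> p = 0 /\ q = 0) ->
  g w1 * g (- w0) = g w0 * g (- w1).
Proof.
move=> ind; pose d : 'rV[R]_n := w1 - w0; pose w (t : R) : 'rV[R]_n := w0 + t *: d.
have w_neq0 t : w t != 0.
  apply/eqP => e; have [] := ind (1 - t) t.
    by rewrite -e /w /d; apply/rowP => i; rewrite !mxE; ring.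
  by clear e => ? ?; lra.
have nw_neq0 t : - w t != 0 by rewrite oppr_eq0.
have hs t : exists s, forall r : R, g (w t) * (1 + s * (r - t)) <= g (w r) /\
    g (- w t) * (1 + s * (r - t)) <= g (- w r).
  have [a [aw h1 h2]] := parallel_supports (w_neq0 t).
  exists (dotr a d) => r; suff <- : dotr a (w r) = 1 + dotr a d * (r - t) by [].
  rewrite -aw /w !(dotrDr a w0) !(dotrZr a _ d); ring.
have /choice[s {}hs] := hs.
have [m m0 hm] := @segment_lower_bound _ _ g w0 d gS (fun t _ => w_neq0 t).
pose K := (g d + g (- d)) / m.
have g0 z : 0 <= g z.
  have [->|/(norm_gt0 gS)/ltW//] := eqVneq z 0.
  by rewrite -(scale0r z) gZ // mul0r.
have sK t : 0 <= t <= 1 -> `|s t| <= K.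
  move=> /hm; rewrite -/(w t) => mt.
  have gt : 0 < g (w t) by apply: norm_gt0.
  have wS r : w (t + r) = w t + r *: d by rewrite /w scalerDl addrA.
  have [+ _] := hs t (t + 1); have [+ _] := hs t (t + (- 1)).
  rewrite !wS scale1r scaleN1r.
  have := norm_triangle gS (w t) d; have := norm_triangle gS (w t) (- d).
  have := g0 d; have := g0 (- d).
  rewrite ler_norml ler_pdivlMr // -mulNr ler_pdivrMr // => ? ? ? ? ? ?.
  by apply/andP; split; nra.
have := @proportional_subgradients R (g \o w) (fun t => g (- w t)) s K.
have w0E : w 0 = w0 by rewrite /w scale0r addr0.
have w1E : w 1 = w1 by rewrite /w scale1r /d addrC subrK.
rewrite /= w0E w1E; apply.
- by move=> t t01; split; [apply: norm_gt0|apply: norm_gt0|apply: sK].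
- by move=> t u _ _; case: (hs t u).
- by move=> t u _ _; case: (hs t u).
Qed.

(** The ratio of g w to g (- w) agrees at independent vectors. Passing from u to - u through v shows
    that it equals its own inverse. *)
Lemma gauge_even u : g (- u) = g u.
Proof.
have [->|u0] := eqVneq u 0; first by rewrite oppr0.
have nu0 : - u != 0 by rewrite oppr_eq0.
have [v [v0 uv _]] := exists_orthogonal2 u u n2.
have nv0 : - v != 0 by rewrite oppr_eq0.
have ind p q : p *: u + q *: v = 0 -> p = 0 /\ q = 0.
  move=> e; have := congr1 (dotr u) e; have := congr1 (dotr v) e.
  rewrite !dotrDr !dotrZr (dotrC v u) uv !mulr0 addr0 add0r !dotr0.
  move=> /eqP + /eqP; rewrite !mulf_eq0 !dotrxx_eq0 (negbTE u0) (negbTE v0) !orbF.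
  by move=> /eqP -> /eqP ->.
have ind' p q : p *: v + q *: (- u) = 0 -> p = 0 /\ q = 0.
  rewrite addrC scalerN -scaleNr => /ind[/eqP + ->].
  by rewrite oppr_eq0 => /eqP ->.
have := antipodal_ratio ind; have := antipodal_ratio ind'; rewrite opprK.
have := norm_gt0 gS u0; have := norm_gt0 gS nu0.
have := norm_gt0 gS v0; have := norm_gt0 gS nv0.
move: (g u) (g (- u)) (g v) (g (- v)) => A A' D D' D'0 D0 A'0 A0 e1 e2.
have : (D - D') * (A' * A * (D + D')) = 0.
  have -> : (D - D') * (A' * A * (D + D')) = (D * A') * (D * A) - (A * D') * (A' * D') by ring.
  by rewrite e2 -e1; ring.
have pos : 0 < A' * A * (D + D') by rewrite !mulr_gt0 // addr_gt0.
move/eqP; rewrite mulf_eq0 (gt_eqF pos) orbF subr_eq0 => /eqP DD.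
by apply: (mulfI (lt0r_neq0 D0)); rewrite e2 DD mulrC.
Qed.

End Gauge.
End ChordsThroughOrigin.

(** * Ellipsoids and conclusion *)

Section Ellipsoids.
Variables (R : realType) (n : nat) (B : set 'rV[R]_n).
Implicit Types (x y z p a : 'rV[R]_n).

Lemma ellipsoid_mem : ellipsoid 0 B ->
  exists2 A : 'M[R]_n, A \in unitmx & forall x, B x <-> dotr (x *m A) (x *m A) <= 1.
Proof.
have sqrt1 x : (Num.sqrt (dotr x x) <= 1) = (dotr x x <= 1).
  by rewrite -[X in _ <= X]sqrtr1 ler_sqrt.
move=> [A Au ->]; exists (invmx A); first by rewrite unitmx_inv.
move=> x; rewrite -sqrt1; split=> /= [[y yb <-]|h].
  by rewrite add0r mulmxK.
by exists (x *m invmx A); rewrite ?add0r ?mulmxKV.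
Qed.

Lemma dotr_mul_continuous m (A : 'M[R]_(n, m)) :
  continuous (fun x => dotr (x *m A) (x *m A)).
Proof.
rewrite (_ : (fun x => _) =
    (fun x => \sum_(j < m) dotr (col j A)^T x * dotr (col j A)^T x)); last first.
  apply/funext => x; apply: eq_bigr => j _; rewrite mxE; congr (_ * _);
  by apply: eq_bigr => i _; rewrite !mxE mulrC.
elim: (index_enum _) => [|j r IH] x.
  under eq_fun do rewrite big_nil.
  exact: cst_continuous.
rewrite (_ : (fun y => _) = (fun y => dotr (col j A)^T y * dotr (col j A)^T y) \+
    (fun y => \sum_(j <- r) dotr (col j A)^T y * dotr (col j A)^T y)); last first.
  by apply/funext => y; rewrite big_cons.
by apply: continuousD; [apply: continuousM; apply: dotr_continuous|exact: IH].
Qed.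

(* The translation moves to 0 the point p of C nearest to 0: x - p and p form an acute
   angle for x in C, so x - p is no longer than x. *)
Lemma ellipsoid_parkable (C : set 'rV[R]_n) : compact B -> ellipsoid 0 B ->
  C !=set0 -> closed C -> convex_set C -> C `<=` B -> parkable C B.
Proof.
move=> cB /ellipsoid_mem[A _ hA] C0 clC /convex_setP vC CB.
have cC : compact C by apply: subclosed_compact CB.
have [p + pmin] := EVT_min_rV C0 cC (continuous_subspaceT (@dotr_mul_continuous n A)).
rewrite inE => Cp; exists (- p); split; first by exists p; rewrite // subrr.
move=> _ [x Cx <-]; apply/hA; have /CB/hA := Cx.
rewrite -{1 2}(subrK p x) mulmxDl; set b := (x - p) *m A; set c := p *m A.
have : 0 <= dotr c b.
  apply: dotr_ge0_of_expanding => t t0 t1.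
  have -> : c + t *: b = (t *: x + (1 - t) *: p) *m A.
    rewrite /c /b mulmxBl mulmxDl -!scalemxAl.
    by apply/rowP => i; rewrite !mxE; ring.
  by apply: pmin; rewrite inE; apply: vC => //; apply: ltW.
rewrite dotrDr !dotrDl (dotrC b c); have := dotrxx_ge0 c; lra.
Qed.

Lemma center_of_symmetryI p (C : set 'rV[R]_n) :
  C p -> (forall x, C x -> C (2 *: p - x)) -> center_of_symmetry p C.
Proof.
move=> Cp h; split=> //; apply/seteqP; split=> x.
  by move=> /h Cx; exists (2 *: p - x) => //; rewrite opprB addrC subrK.
by move=> [y /h Cy <-].
Qed.

Lemma ellipsoid_centrally_symmetric : ellipsoid 0 B -> centrally_symmetric B.
Proof.
move=> /ellipsoid_mem[A _ hA].
have B0 : B 0 by apply/hA; rewrite mul0mx dotr0.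
split=> //; apply: center_of_symmetryI => // x.
by rewrite scaler0 sub0r !hA mulNmx dotrNl dotrNr opprK.
Qed.

(** In the coordinates x A, where B is the Euclidean ball, the center is the foot (b / N) a' of the
    perpendicular from 0. It lies in B by Cauchy-Schwarz applied to a point x0 of the section. *)
Lemma ellipsoid_section H : ellipsoid 0 B -> affine_hyperplane H ->
  B `&` H !=set0 -> has_center_of_symmetry (B `&` H).
Proof.
move=> /ellipsoid_mem[A Au hA] [a [b [a0 ->]]] [x0 [/hA Bx0 /= ax0]].
pose a' := a *m (invmx A)^T.
have aE x : dotr a x = dotr a' (x *m A).
  have dE (c d : 'rV[R]_n) : dotr c d = (c *m d^T) 0 0.
    by rewrite mxE; apply: eq_bigr => i _; rewrite mxE.
  by rewrite !dE /a' trmx_mul -mulmxA (mulmxA _ A^T) -trmx_mul mulmxV // trmx1 mul1mx.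
have a'0 : a' != 0.
  by apply: contra_neq a0 => e; apply/eqP; rewrite -dotrxx_eq0 aE e dotrC dotr0.
set N := dotr a' a'; have N0 : 0 < N by exact: dotrxx_gt0.
pose p := (b / N) *: (a' *m invmx A).
have pA : p *m A = (b / N) *: a' by rewrite -scalemxAl mulmxKV.
have yE : dotr a' (x0 *m A) = b by rewrite -aE.
exists p; apply: center_of_symmetryI.
  split=> /=; last by rewrite aE pA dotrZr divfK // gt_eqF.
  apply/hA; rewrite pA dotrZl dotrZr -/N divfK ?gt_eqF // mulrAC ler_pdivrMr // mul1r.
  have := dotrxx_ge0 (N *: (x0 *m A) - b *: a').
  rewrite dotr_sqB !dotrZl dotrZr yE -/N => h.
  have : 0 <= N * (N * dotr (x0 *m A) (x0 *m A) - b * b) by lra.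
  by rewrite pmulr_rge0 //; nra.
move=> x [/hA Bx /= ax]; split=> /=; last first.
  by rewrite dotrBr dotrZr ax aE pA dotrZr divfK ?gt_eqF //; ring.
apply/hA; rewrite mulmxBl -scalemxAl pA dotr_sqB dotrZl dotrZr -/N.
rewrite (dotrC _ ((b / N) *: a')) dotrZl -aE ax.
have -> : b / N * (b / N * N) = b / N * b by rewrite divfK // gt_eqF.
lra.
Qed.

End Ellipsoids.

Section Characterization.
Variables (R : realType) (n : nat) (B : set 'rV[R]_n).
Hypotheses (n2 : (2 < n)%N) (cB : compact B) (vB : convex_set B).
Implicit Types (x y z p a c : 'rV[R]_n).

(** A small z is the midpoint of x0 + z and - (x0 - z). *)
Lemma symmetric_origin_interior : interior B !=set0 -> (forall x, B x -> B (- x)) ->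
  interior B 0.
Proof.
move=> [x0 /nbhs_ballP[e /= e0 eB]] BN; apply/nbhs_ballP; exists e => //= z.
rewrite -ball_normE /= sub0r normrN => ze.
have B1 : B (x0 + z) by apply: eB; rewrite -ball_normE /= opprD addrA subrr sub0r normrN.
have B2 : B (- (x0 - z)).
  by apply: BN; apply: eB; rewrite -ball_normE /= opprD addrA subrr sub0r opprK.
have -> : z = 2^-1 *: (x0 + z) + (1 - 2^-1) *: (- (x0 - z)).
  by apply/rowP => i; rewrite !mxE; field.
by move/convex_setP: vB; apply => //; lra.
Qed.

(** Common end of both implications: c is the center of the section under (ii), and the point of the
    section that parking moves to 0 under (iii). *)
Lemma ellipsoid_of_sections : interior B 0 -> (forall x, B x -> B (- x)) ->
  (forall a (b : R), a != 0 -> (exists2 x, B x & dotr a x = b) ->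
    exists2 c, dotr a c = b & forall x, B x -> dotr a x = b -> B (x - c)) ->
  ellipsoid 0 B.
Proof.
move=> iB BN sec; have [g gS Bg] := exists_gauge cB vB iB.
have gZ t x : 0 <= t -> g (t *: x) = t * g x by case: gS => _ h _ _; apply: h.
have gN_le x : g (- x) <= g x.
  have [->|x0] := eqVneq x 0; first by rewrite oppr0.
  have gx := norm_gt0 gS x0.
  have /BN/Bg : B ((g x)^-1 *: x).
    by apply/Bg; rewrite gZ ?invr_ge0 ?(ltW gx) // mulVf // gt_eqF.
  by rewrite -scalerN gZ ?invr_ge0 ?(ltW gx) // ler_pdivrMl // mulr1.
have gN x : g (- x) = g x.
  by apply/eqP; rewrite eq_le gN_le; have := gN_le (- x); rewrite opprK.
have kT : complemented g setT.
  apply: complemented_of_sections => // a b a0 [x /Bg Bx ax].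
  have [|c ac hc] := sec a b a0; first by exists x.
  by exists c => // y /Bg By ay; apply/Bg; apply: hc.
have [|Q [Qs hQ]] := euclidean_form gS gN (fun x hx => exists_reflection gS gN n2 kT hx).
  exact: leq_trans n2.
have -> : B = [set x | g x <= 1] by apply/seteqP; split=> x /Bg.
apply: (norm_ball_ellipsoid (Q := Q)) => //; first exact: norm_ge0.
exact: norm_gt0.
Qed.

Lemma parkable_chord : (forall C : set 'rV[R]_n,
    C !=set0 -> closed C -> convex_set C -> C `<=` B -> parkable C B) ->
  forall x y, B x -> B y -> exists2 t : R, 0 <= t <= 1 &
    B (t *: (x - y)) /\ B (- ((1 - t) *: (x - y))).
Proof.
move=> park x y Bx By; pose f (t : R) : 'rV[R]_n := t *: (x - y) + y.
have cf : continuous f.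
  by move=> t; apply: cvgD; [apply: cvgZr_tmp; exact: cvg_id|exact: cvg_cst].
have [||||v [[_ [t + <-] tv] vC]] := park (f @` `[0, 1]).
- by exists (f 0), 0; rewrite //= in_itv /= lexx ler01.
- apply: compact_closed; first exact: norm_hausdorff.
  by apply: continuous_compact; [exact: continuous_subspaceT|exact: segment_compact].
- apply/convex_setP => _ _ r [s + <-] [t + <-] r0 r1; rewrite /= !in_itv /=.
  move=> /andP[s0 s1] /andP[t0 t1]; exists (r * s + (1 - r) * t).
    by rewrite /= in_itv /=; apply/andP; split; nra.
  by apply/rowP => i; rewrite !mxE; ring.
- move=> _ [t + <-]; rewrite /= in_itv /= => /andP[t0 t1].
  have -> : f t = t *: x + (1 - t) *: y by apply/rowP => i; rewrite !mxE; ring.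
  by move/convex_setP: vB; apply.
rewrite /= in_itv /= => /andP[t0 t1].
have vE : v = - f t by apply/eqP; rewrite -addr_eq0 addrC tv.
exists (1 - t); first by apply/andP; split; lra.
split.
  apply: vC; exists (f 1); first by exists 1; rewrite //= in_itv /= lexx ler01.
  by rewrite vE; apply/rowP => i; rewrite !mxE; ring.
apply: vC; exists (f 0); first by exists 0; rewrite //= in_itv /= lexx ler01.
by rewrite vE; apply/rowP => i; rewrite !mxE; ring.
Qed.

End Characterization.

Theorem theorem8 (R : realType) (n : nat) (B : set 'rV[R]_n) :
  (2 < n)%N -> convex_body B ->
  let i := ellipsoid 0 B in
  let ii :=
    centrally_symmetric B /\
    (forall H : set 'rV[R]_n, affine_hyperplane H ->
      (B `&` H) !=set0 -> has_center_of_symmetry (B `&` H)) in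
  let iii :=
    forall C : set 'rV[R]_n,
      C !=set0 -> closed C -> convex_set C -> C `<=` B -> parkable C B in
  (i <-> ii) /\ (ii <-> iii).
Proof.
move=> n2 [cB vB iB B0] i ii iii.
have i_ii : i -> ii.
  by move=> h; split=> [|H]; [exact: ellipsoid_centrally_symmetric|exact: ellipsoid_section].
have i_iii : i -> iii by move=> h C; exact: ellipsoid_parkable.
have ii_i : ii -> i.
  move=> [[_ [_ Bsym]] sec].
  have BN x : B x -> B (- x).
    by rewrite {2}Bsym => Bx; exists x; rewrite // scaler0 sub0r.
  apply: ellipsoid_of_sections => //; first exact: symmetric_origin_interior.
  move=> a b a0 [x Bx ax].
  have [||p [[Bp ap] sym]] := sec [set x | dotr a x = b].
  - by exists a, b.
  - by exists x.
  exists p => // y By ay.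
  have [] : (B `&` [set x | dotr a x = b]) (2 *: p - y) by rewrite sym; exists y.
  (* By symmetry of B the point y - 2 p is in B, and its midpoint with y is y - p. *)
  move=> /BN B2 _; move/convex_setP: vB => /(_ _ _ 2^-1 By B2).
  have -> : 2^-1 *: y + (1 - 2^-1) *: (- (2 *: p - y)) = y - p.
    by apply/rowP => j; rewrite !mxE; field.
  by apply; lra.
have iii_i : iii -> i.
  move=> park; have chord := parkable_chord vB park.
  have iB0 := origin_interior n2 cB vB iB B0 chord.
  have [g gS Bg] := exists_gauge cB vB iB0.
  have gE := gauge_even n2 cB vB B0 chord gS Bg.
  apply: ellipsoid_of_sections => //; first by move=> x; rewrite !Bg gE.
  move=> a b a0 [x Bx ax].
  have clB : closed B by apply: compact_closed cB; apply: norm_hausdorff.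
  have [||||v [[y [By ay] yv] vC]] := park (B `&` [set x | dotr a x = b]).
  - by exists x.
  - apply: closedI => //; rewrite (_ : [set x | _] = [set x | dotr x a = b]).
      exact: dotr_closed_eq.
    by apply/seteqP; split=> z /=; rewrite dotrC.
  - apply/convex_setP => y z t [By ay] [Bz az] t0 t1; split.
      by move/convex_setP: vB; apply.
    by rewrite /= dotrDr !dotrZr ay az; ring.
  - by move=> y [].
  have vE : v = - y by apply/eqP; rewrite -addr_eq0 addrC yv.
  exists y => // z Bz az; apply: vC; exists z => //.
  by rewrite vE.
split; split => //; first by move/ii_i/i_iii.
by move/iii_i/i_ii.
Qed.
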